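(* Let $K$ be a field, $S=K[x_1,\ldots,x_n]$, and let $(0)\neq I\subset S$ be a proper squarefree monomial ideal. If $n\leq 5$, then $\operatorname{hdepth}(I)\geq \operatorname{hdepth}(S/I)+1$.
   Context: $S=K[x_1,\ldots,x_n]$ is the polynomial ring over a field $K$ with its standard grading. For a nonzero finitely generated graded $S$-module $M$, the Hilbert depth $\operatorname{hdepth}(M)$ is the maximal depth of a finitely generated graded $S$-module $N$ having the same Hilbert series as $M$. *)

(* Defs.v *)
From Stdlib Require Import ClassicalEpsilon.
From HB Require Import structures.
From mathcomp Require Import all_boot all_order all_algebra ring_quotient.
From mathcomp Require Import mpoly.

Set Implicit Arguments.
Unset Strict Implicit.
Unset Printing Implicit Defensive.

Import GRing.Theory.
Local Open Scope ring_scope.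
Local Open Scope quotient_scope.

(* The maximum of P; unspecified when P is empty or unbounded, which does not
   happen below for nonzero finitely generated graded modules, as their depth is
   at most the number of variables. *)
Definition max_nat (P : nat -> Prop) : nat :=
  epsilon (inhabits 0%N) (fun m => P m /\ forall k, P k -> (k <= m)%N).

Section GradedModules.
Variables (K : fieldType) (n : nat).
Local Notation S := {mpoly K[n]}.
Implicit Type M : lmodType S.

(* gr d is the component of degree d of a Z-graded module. Closure under
   opposites and K-scaling follows from gradingZ with e = 0. *)
Record is_grading M (gr : int -> M -> Prop) : Prop := IsGrading {
  grading0 : forall d, gr d 0;
  gradingD : forall d u v, gr d u -> gr d v -> gr d (u + v);
  gradingZ : forall (e : nat) d (p : S) v,
    p \is e.-homog -> gr d v -> gr (e%:Z + d) (p *: v);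
  grading_sum : forall v, exists (s : seq int) (f : int -> M),
    [/\ uniq s, forall d, gr d (f d) & v = \sum_(d <- s) f d];
  grading_direct : forall (s : seq int) (f : int -> M),
    uniq s -> (forall d, gr d (f d)) -> \sum_(d <- s) f d = 0 ->
    forall d, d \in s -> f d = 0
}.

Definition finitely_generated M : Prop :=
  exists (k : nat) (g : 'I_k -> M),
    forall v, exists c : 'I_k -> S, v = \sum_(i < k) c i *: g i.

(* W is a K-subspace of M of dimension r: it has a basis of r vectors. *)
Definition has_dim M (W : M -> Prop) (r : nat) : Prop :=
  exists b : 'I_r -> M, (forall c : {ffun 'I_r -> K},
      W (\sum_(i < r) (c i)%:MP *: b i)) /\
    forall v, W v ->
      exists! c : {ffun 'I_r -> K}, v = \sum_(i < r) (c i)%:MP *: b i.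

(* d |-> dim_K M_d, the coefficients of the Hilbert series; the components of
   a finitely generated graded module are finite dimensional. *)
Definition hilbert_function M (gr : int -> M -> Prop) (d : int) : nat :=
  epsilon (inhabits 0%N) (has_dim (gr d)).

(* v belongs to (r_0, ..., r_(k-1)) M, where rs = [:: r_0; ...; r_(k-1)]. *)
Definition in_seq_mul M (rs : seq S) (v : M) : Prop :=
  exists w : nat -> M, v = \sum_(i < size rs) rs`_i *: w i.

Definition regular_sequence M (rs : seq S) : Prop :=
  (forall i, (i < size rs)%N -> forall v : M,
     in_seq_mul (take i rs) (rs`_i *: v) -> in_seq_mul (take i rs) v)
  /\ (exists v : M, ~ in_seq_mul rs v).

(* The maximal length of a regular sequence on M in (x_1, ..., x_n), the ideal
   of the polynomials without constant term. *)
Definition depth M : nat :=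
  max_nat (fun k => exists rs : seq S,
    [/\ size rs = k, {in rs, forall p, p@_0%MM = 0} & regular_sequence M rs]).

Definition hdepth M (gr : int -> M -> Prop) : nat :=
  max_nat (fun k => exists (N : lmodType S) (grN : int -> N -> Prop),
    [/\ is_grading grN, finitely_generated N,
        hilbert_function grN =1 hilbert_function gr & depth N = k]).

(* The component of degree d of S itself, which is 0 when d < 0. *)
Definition mpoly_gr (d : int) (p : S) : bool :=
  if d is Posz e then p \is e.-homog else p == 0.

End GradedModules.

(* An ideal (an idealr is proper by definition) and the quotient by it, as
   modules over the ring. *)
Section IdealModules.
Variables (R : comNzRingType) (I : idealr R).

Record ideal_module := IdealModule {
  ideal_val :> R^o;
  _ : (I : pred R) ideal_val
}.

Lemma ideal_submod_closed : submod_closed ((I : pred R) : {pred R^o}).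
Proof.
split=> [|a u v uI vI]; first exact: (rpred0 I).
by apply: (rpredD (S := I)) => //; exact: idealMr.
Qed.

HB.instance Definition _ := [isSub for ideal_val].
HB.instance Definition _ := [Choice of ideal_module by <:].
HB.instance Definition _ := GRing.SubChoice_isSubLmodule.Build
  R R^o (I : pred R) ideal_module (GRing.submod_closed_semi ideal_submod_closed).

Definition quot_scale (a : R) (u : {ideal_quot I}) : {ideal_quot I} :=
  \pi_{ideal_quot I} a * u.

Lemma quot_scaleA a b u : quot_scale a (quot_scale b u) = quot_scale (a * b) u.
Proof. by rewrite /quot_scale rmorphM mulrA. Qed.
Lemma quot_scale1 : left_id 1 quot_scale.
Proof. by move=> u; rewrite /quot_scale rmorph1 mul1r. Qed.
Lemma quot_scaleDr : right_distributive quot_scale +%R.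
Proof. by move=> a u v; rewrite /quot_scale mulrDr. Qed.
Lemma quot_scaleDl u : {morph quot_scale^~ u : a b / a + b}.
Proof. by move=> a b; rewrite /quot_scale rmorphD mulrDl. Qed.

HB.instance Definition _ := GRing.Zmodule_isLmodule.Build R {ideal_quot I}
  quot_scaleA quot_scale1 quot_scaleDr quot_scaleDl.

End IdealModules.

Section MonomialIdeals.
Variables (K : fieldType) (n : nat).
Local Notation S := {mpoly K[n]}.
Implicit Type I : idealr S.

Definition squarefree_monomial (m : 'X_{1..n}) : bool :=
  [forall i, (m i <= 1)%N].

(* There are finitely many squarefree monomials, so taking a finite generating
   family is no restriction. *)
Definition squarefree_monomial_ideal I : Prop :=
  exists (k : nat) (g : 'I_k -> 'X_{1..n}),
    (forall i, squarefree_monomial (g i)) /\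
    forall p : S, p \in I <->
      exists c : 'I_k -> S, p = \sum_(i < k) c i * 'X_[g i].

Definition ideal_gr I (d : int) (u : ideal_module I) : Prop :=
  mpoly_gr d (ideal_val u).

Definition quot_gr I (d : int) (u : {ideal_quot I}) : Prop :=
  exists2 p : S, mpoly_gr d p & u = \pi_{ideal_quot I} p.

Lemma mpoly_gr0 d : mpoly_gr d (0 : S).
Proof. by case: d => d /=; rewrite ?dhomog0. Qed.

Lemma mpoly_grD d (p q : S) : mpoly_gr d p -> mpoly_gr d q -> mpoly_gr d (p + q).
Proof.
case: d => d /=; first exact: dhomogD.
by move=> /eqP-> /eqP->; rewrite addr0.
Qed.

Lemma mpoly_grM (e : nat) d (p q : S) :
  p \is e.-homog -> mpoly_gr d q -> mpoly_gr (e%:Z + d) (p * q).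
Proof.
case: d => d /= hp; first exact: dhomogM.
by move=> /eqP->; rewrite mulr0 mpoly_gr0.
Qed.

Definition mpoly_proj (d : int) (p : S) : S :=
  if d is Posz e then pihomog mdeg e p else 0.

Lemma mpoly_projP d p : mpoly_gr d (mpoly_proj d p).
Proof. by case: d => d //=; exact: pihomogP. Qed.

Lemma mpoly_proj_sum p : exists2 s, uniq s & p = \sum_(d <- s) mpoly_proj d p.
Proof.
exists [seq Posz i | i <- iota 0 (msize p)].
  by rewrite map_inj_uniq ?iota_uniq // => i j [].
rewrite big_map -[msize p in RHS]subn0 -/(index_iota _ _) big_mkord.
exact: pihomog_partitionE.
Qed.

Lemma mpoly_proj_sumE (s : seq int) (f : int -> S) d :
  uniq s -> (forall e, mpoly_gr e (f e)) -> d \in s ->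
  mpoly_proj d (\sum_(e <- s) f e) = f d.
Proof.
move=> s_uniq hf ds; case: d ds => d ds /=; last by have /eqP := hf (Negz d).
rewrite raddf_sum (bigD1_seq _ ds s_uniq) /= pihomog_dE; last exact: (hf (Posz d)).
rewrite big1 ?addr0 // => -[e|e] ne; last first.
  by have /eqP-> := hf (Negz e); rewrite raddf0.
by apply: pihomog_ne0 (hf (Posz e)); apply: contraNneq ne => ->.
Qed.

Lemma squarefree_proj I d p :
  squarefree_monomial_ideal I -> p \in I -> mpoly_proj d p \in I.
Proof.
move=> [k [g [_ IG]]]; case: d => d /=; last by rewrite (rpred0 I).
have XI i : 'X_[g i] \in I.
  apply/IG; exists (fun j => (j == i)%:R).
  rewrite (bigD1 i) //= eqxx mul1r big1 ?addr0 // => j /negPf->.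
  by rewrite mul0r.
move=> /IG [c ->]; rewrite raddf_sum /=; apply: (rpred_sum (S := I)) => i _.
rewrite [c i]mpolyE mulr_suml raddf_sum /=; apply: (rpred_sum (S := I)) => m _.
rewrite -scalerAl -mpolyXD linearZ /= pihomogX -mul_mpolyC; apply: idealMr.
case: ifP => _; last by rewrite (rpred0 I).
by rewrite mpolyXD; apply: idealMr; exact: XI.
Qed.

Lemma ideal_gr_is_grading I :
  squarefree_monomial_ideal I -> is_grading (@ideal_gr I).
Proof.
move=> sqI; split.
- by move=> d; exact: mpoly_gr0.
- by move=> d u v; exact: mpoly_grD.
- by move=> e d p v; exact: mpoly_grM.
- move=> v; have [s s_uniq vE] := mpoly_proj_sum (ideal_val v).
  have fI d : (I : pred S) (mpoly_proj d (ideal_val v)).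
    by apply: squarefree_proj => //; case: (v).
  exists s, (fun d => IdealModule (fI d)); split=> // [d|].
    exact: mpoly_projP.
  by apply: val_inj; rewrite raddf_sum.
- move=> s f s_uniq hf /(congr1 val); rewrite raddf_sum raddf0 => f0 d ds.
  apply: val_inj; rewrite raddf0 /=.
  rewrite -(mpoly_proj_sumE (f := fun e => val (f e)) s_uniq hf ds) f0.
  by case: (d) => // e /=; rewrite raddf0.
Qed.

Lemma quot_gr_is_grading I :
  squarefree_monomial_ideal I -> is_grading (@quot_gr I).
Proof.
move=> sqI; split.
- by move=> d; exists 0; rewrite ?mpoly_gr0 ?rmorph0.
- move=> d _ _ [p hp ->] [q hq ->]; exists (p + q); rewrite ?rmorphD //.
  exact: mpoly_grD.
- move=> e d p _ hp [q hq ->]; exists (p * q); rewrite ?rmorphM //.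
  exact: mpoly_grM.
- move=> v; have [s s_uniq vE] := mpoly_proj_sum (repr v).
  exists s, (fun d => \pi_{ideal_quot I} (mpoly_proj d (repr v))).
  split=> // [d|].
    by exists (mpoly_proj d (repr v)) => //; exact: mpoly_projP.
  by rewrite -[LHS]reprK [in LHS]vE rmorph_sum.
- move=> s f s_uniq hf.
  pose P d (p : S) := mpoly_gr d p /\ f d = \pi_{ideal_quot I} p.
  pose g d := epsilon (inhabits 0) (P d).
  have gP d : P d (g d).
    by apply: (epsilon_spec (inhabits 0) (P d)); have [p] := hf d; exists p.
  have piI p : (p \in I) = (\pi_{ideal_quot I} p == 0).
    by rewrite -[p in LHS]subr0 Quotient.idealrBE [X in _ == X]rmorph0.
  under eq_bigr do rewrite (gP _).2.
  rewrite -rmorph_sum /= => /eqP; rewrite -piI => gI d ds.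
  rewrite (gP d).2 -(mpoly_proj_sumE s_uniq (fun e => (gP e).1) ds).
  by apply/eqP; rewrite -piI; exact: squarefree_proj.
Qed.

Lemma ideal_module_fg I :
  squarefree_monomial_ideal I -> finitely_generated (ideal_module I).
Proof.
move=> [k [g [_ IG]]].
have XI i : (I : pred S) 'X_[g i].
  apply/IG; exists (fun j => (j == i)%:R).
  rewrite (bigD1 i) //= eqxx mul1r big1 ?addr0 // => j /negPf->.
  by rewrite mul0r.
exists k, (fun i => IdealModule (XI i)) => v.
have /IG [c vE] : ideal_val v \in I by case: v.
by exists c; apply: val_inj; rewrite raddf_sum.
Qed.

Lemma ideal_quot_fg I : finitely_generated {ideal_quot I}.
Proof.
exists 1%N, (fun=> 1) => v; exists (fun=> repr v).
by rewrite big_ord1 -[LHS]reprK -[RHS]/(\pi_{ideal_quot I} (repr v) * 1) mulr1.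
Qed.

End MonomialIdeals.

Arguments ideal_gr {K n} I d u.
Arguments quot_gr {K n} I d u.

(* Main.v *)
Require Import Defs.
From Stdlib Require Import Classical ClassicalEpsilon.
From HB Require Import structures.
From mathcomp Require Import all_boot all_order all_algebra ring_quotient.
From mathcomp Require Import mpoly.

Set Implicit Arguments.
Unset Strict Implicit.
Unset Printing Implicit Defensive.

Import GRing.Theory.
Local Open Scope ring_scope.

(** For a graded module let [H] be its Hilbert function and let [diff] be the
    backward difference, that is, multiplication of the Hilbert series by
    [1 - t].  Hilbert depth is controlled by the signs of the iterated
    differences of [H], and this reduces the theorem to finitely many
    inequalities between face numbers of simplicial complexes.

    Depth forces positivity ([regular_diff_ge0]): if a finitely generated graded
    module [N] has a regular sequence of length [k] inside [(x_1, ..., x_n)],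
    then the [k]-th difference of its Hilbert function is nonnegative.  For a
    sequence of linear forms this is immediate, as each quotient multiplies the
    series by [1 - t]; but the sequence need not be homogeneous, and over a
    finite field there may be no regular linear form.  The link is Koszul
    cohomology: a regular sequence of length [k] makes [H^i(x_1, ..., x_n; N)]
    vanish for [i < k] ([koszul_exact_step]), a property of the graded pieces
    that survives extension of scalars.  As soon as [H^0] vanishes, the generic
    form [x_1 + t x_2 + t^2 x_3 + ...] is injective on [N] over [K(t)]: this is
    McCoy's argument on zero divisors in polynomial rings ([lin_poly_inj]).
    Dividing by it lowers the vanishing range by one ([gexact_quot]) and takes
    one difference of the dimensions; this is repeated [k] times
    ([gexact_diff_ge0]).

    Positivity yields depth ([polysum_exists]): for a squarefree monomial module
    with [a_j] squarefree monomials of degree [j], the Hilbert series is the sum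
    of the [a_j t^j / (1 - t)^j].  Bringing the terms with [j <= d] over the
    denominator [(1 - t)^d] gives coefficients [beta a d e]; if they are
    nonnegative, the series is that of a direct sum of shifted polynomial rings
    in at least [d] variables ([hseries_decomp]), on which [x_1, ..., x_d] is
    regular.

    Applied to [S/I] and [I], these two facts leave the following statement on
    the simplicial complex of the squarefree monomials outside [I]: if its face
    numbers satisfy the inequalities for [k], the complementary numbers satisfy
    them for [k + 1] ([beta_complement]).  Splitting the complex into the
    deletion and the link of a vertex, the link having at most as many faces as
    the deletion in each dimension, produces by recursion a short list that
    contains all face vectors on at most five vertices, and the implication
    holds for every vector of the list ([hdepth_check_le5]). *)

(** * Koszul cochains *)

Lemma subrACA (V : zmodType) (a b c d : V) : a - b - (c - d) = a - c - (b - d).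
Proof. by rewrite opprD addrACA -opprD. Qed.

Section Koszul.
Variables (I : Type) (M M' : zmodType) (f : I -> M -> M').

(** The Koszul differential of the commuting operators [f i], [i] in [l].
    A cochain is indexed by bit lists, a bit telling whether the corresponding
    operator belongs to the index set, so its cohomological degree is the number
    of bits set.  Building the complex as an iterated mapping cone, one operator
    at a time, keeps explicit signs away.  Source and target differ so that the
    operators can be the maps between two consecutive graded pieces. *)
Fixpoint kosz (l : seq I) (c : seq bool -> M) (s : seq bool) : M' :=
  match l, s with
  | i :: l', true :: s' => f i (c (false :: s')) - kosz l' (c \o cons true) s'
  | _ :: l', false :: s' => kosz l' (c \o cons false) s'
  | _, _ => 0
  end.

(** The differential raises the cohomological degree by exactly one: its value at
    [s] only involves index sets with one element less. *)
Lemma kosz_ext l c c' s :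
  (forall t, size t = size s -> (count id t).+1 = count id s -> c t = c' t) ->
  kosz l c s = kosz l c' s.
Proof.
elim: l s c c' => [|i l IHl] [|[] s] c c' //= eq_c.
  congr (_ - _); first by rewrite eq_c.
  by apply: IHl => t st ct /=; apply: eq_c; rewrite /= ?st // -ct.
by apply: IHl => t st ct /=; apply: eq_c; rewrite /= ?st // -ct.
Qed.

Hypothesis fB : forall i, {morph f i : u v / u - v}.

Lemma koszB l c c' s :
  kosz l (fun t => c t - c' t) s = kosz l c s - kosz l c' s.
Proof.
elim: l s c c' => [|i l IHl] [|[] s] c c' /=; rewrite ?subr0 //.
  by rewrite fB (IHl s (c \o _) (c' \o _)) subrACA.
exact: (IHl s (c \o _) (c' \o _)).
Qed.

Lemma kosz0 l s : kosz l (fun=> 0) s = 0.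
Proof.
rewrite -[RHS](subrr (kosz l (fun=> 0) s)) -koszB.
by apply: kosz_ext => t; rewrite subrr.
Qed.

Lemma koszN l c s : kosz l (fun t => - c t) s = - kosz l c s.
Proof.
by rewrite -[RHS]sub0r -(kosz0 l s) -koszB; apply: kosz_ext => t; rewrite sub0r.
Qed.

Lemma koszD l c c' s :
  kosz l (fun t => c t + c' t) s = kosz l c s + kosz l c' s.
Proof.
by rewrite -[in RHS](opprK (kosz l c' s)) -koszN -koszB;
  apply: kosz_ext => t; rewrite opprK.
Qed.

Lemma kosz_sub (W : M -> Prop) (W' : M' -> Prop) l c s :
  W' 0 -> (forall u v, W' u -> W' v -> W' (u - v)) ->
  (forall i v, W v -> W' (f i v)) ->
  (forall t, size t = size s -> W (c t)) -> W' (kosz l c s).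
Proof.
move=> W0 WB Wf; elim: l s c => [|i l IHl] [|[] s] c //= Wc.
  by apply: WB; [apply/Wf/Wc | apply: IHl => t /= st; apply: Wc; rewrite /= st].
by apply: IHl => t /= st; apply: Wc; rewrite /= st.
Qed.

End Koszul.

Lemma kosz_map I (M M' P P' : zmodType) (f : I -> M -> M') (e : I -> P -> P')
    (g : M -> P) (g' : M' -> P') l c s :
  {morph g' : u v / u - v} -> (forall i v, g' (f i v) = e i (g v)) ->
  g' (kosz f l c s) = kosz e l (g \o c) s.
Proof.
move=> gB gf; have g0 : g' 0 = 0 by rewrite -(subrr 0) gB subrr.
by elim: l s c => [|i l IHl] [|[] s] c //=; rewrite ?gB ?gf IHl.
Qed.

Lemma kosz_kosz I (M M' M'' : zmodType) (f : I -> M -> M') (f' : I -> M' -> M'')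
    l c s :
  (forall i, {morph f i : u v / u - v}) ->
  (forall i, {morph f' i : u v / u - v}) ->
  (forall i j v, f' i (f j v) = f' j (f i v)) ->
  kosz f' l (kosz f l c) s = 0.
Proof.
move=> fB fB' ff; elim: l s c => [|i l IHl] [|[] s] c //=; last exact: IHl.
rewrite [X in _ - X](koszB fB' l (f i \o (c \o cons false))
   (kosz f l (c \o cons true))) IHl subr0.
rewrite -(kosz_map (f := f) (g' := f' i) l (c \o cons false)) //.
by rewrite subrr.
Qed.

Section Homotopy.
Variables (R : comNzRingType) (N : lmodType R) (I : Type) (x a : I -> R).

Let D := kosz (fun i (v : N) => x i *: v).

(** Contraction of cochains with the vector of coefficients [a]; it lowers the
    cohomological degree by one. *)
Fixpoint contract (l : seq I) (c : seq bool -> N) (s : seq bool) : N :=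
  match l, s with
  | _ :: l', true :: s' => - contract l' (c \o cons true) s'
  | i :: l', false :: s' =>
      a i *: c (true :: s') + contract l' (c \o cons false) s'
  | _, _ => 0
  end.

Lemma contract_eq0 l c s :
  (forall t, size t = size s -> count id t = (count id s).+1 -> c t = 0) ->
  contract l c s = 0.
Proof.
elim: l s c => [|i l IHl] [|[] s] c //= c0.
  by rewrite IHl ?oppr0 // => t st ct /=; apply: c0; rewrite /= ?st // ct.
rewrite c0 // scaler0 add0r.
by apply: IHl => t st ct /=; apply: c0; rewrite /= ?st // ct.
Qed.

Lemma contract_sub (W : N -> Prop) l c s :
  W 0 -> (forall u v, W u -> W v -> W (u + v)) ->
  (forall (p : R) v, W v -> W (p *: v)) ->
  (forall t, size t = size s -> W (c t)) -> W (contract l c s).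
Proof.
move=> W0 WD WZ; elim: l s c => [|i l IHl] [|[] s] c //= Wc.
  rewrite -scaleN1r; apply/WZ/IHl => t st; apply: Wc; by rewrite /= st.
by apply: WD; [apply/WZ/Wc | apply: IHl => t st; apply: Wc; rewrite /= st].
Qed.

Lemma contractB l c c' s :
  contract l (fun t => c t - c' t) s = contract l c s - contract l c' s.
Proof.
elim: l s c c' => [|i l IHl] [|[] s] c c' /=; rewrite ?subr0 //.
  by rewrite (IHl s (c \o _) (c' \o _)) opprB opprK addrC.
by rewrite (IHl s (c \o _) (c' \o _)) scalerBr opprD addrACA.
Qed.

Lemma contractZ l (p : R) c s :
  contract l (fun t => p *: c t) s = p *: contract l c s.
Proof.
elim: l s c => [|i l IHl] [|[] s] c /=; rewrite ?scaler0 //.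
  by rewrite (IHl s (c \o _)) scalerN.
by rewrite (IHl s (c \o _)) scalerDr !scalerA mulrC.
Qed.

(** Contraction is a homotopy between zero and multiplication by
    [\sum_i a_i x_i]; hence the ideal generated by the [x_i] annihilates the
    Koszul cohomology. *)
Lemma kosz_homotopy l c s : size s = size l ->
  D l (contract l c) s + contract l (D l c) s =
    (\sum_(i <- l) a i * x i) *: c s.
Proof.
have xB i : {morph (fun v : N => x i *: v) : u v / u - v}.
  by move=> u v; rewrite scalerBr.
elim: l s c => [|i l IHl] [|b s] c //=; first by rewrite big_nil addr0 scale0r.
move=> [sz]; rewrite big_cons scalerDl; case: b => /=.
  rewrite -[in RHS](IHl s (c \o cons true)) //.
  rewrite /D (contractB _ (fun t => x i *: c (false :: t))
    (kosz _ l (c \o cons true))) (contractZ _ _ (c \o cons false)).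
  rewrite (koszN xB l (contract l (c \o cons true))).
  rewrite opprK opprB scalerDr scalerA [x i * _]mulrC.
  rewrite -!addrA; congr (_ + _); by rewrite addrC -!addrA addNr addr0.
rewrite -[in RHS](IHl s (c \o cons false)) //.
have -> : D l (contract (i :: l) c \o cons false) s =
   a i *: D l (c \o cons true) s + D l (contract l (c \o cons false)) s.
  rewrite [a i *: _](kosz_map (P := N) (P' := N) (g' := *:%R (a i))
      (g := *:%R (a i)) (e := fun i v => x i *: v)) -?koszD //.
    by move=> u v; rewrite scalerBr.
  by move=> j v; rewrite !scalerA mulrC.
rewrite scalerBr scalerA.
set u := a i *: _; set v := (a i * x i) *: _; set y := D _ _ _.
by rewrite addrACA [u + _]addrC subrK.
Qed.

End Homotopy.

(** * A regular sequence makes Koszul cohomology vanish *)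

Section Grade.
Variables (R : comNzRingType) (N : lmodType R) (I : Type) (x : I -> R).
Variable l : seq I.

Let D := kosz (fun i (v : N) => x i *: v) l.

Definition submodule_pred (W : N -> Prop) :=
  [/\ W 0, forall u v, W u -> W v -> W (u + v) &
      forall (p : R) v, W v -> W (p *: v)].

Definition add_mult (W : N -> Prop) (r : R) (v : N) :=
  exists w e, W w /\ v = w + r *: e.

(** Vanishing of the Koszul cohomology of [N/W] in degrees below [k].  It is
    phrased with cochains of [N] modulo the submodule [W], so that the successive
    quotients by a regular sequence need not be formed. *)
Definition koszul_exact (W : N -> Prop) (k : nat) :=
  forall i (c : seq bool -> N), (i < k)%N ->
    (forall s, size s = size l -> count id s != i -> c s = 0) ->
    (forall s, size s = size l -> W (D c s)) ->
  exists b, forall s, size s = size l -> W (c s - D b s).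

(** The long exact sequence of multiplication by [r] on [N/W] shows that
    the kernel of [r] on [H^(i+1)(N/W)] is a quotient of [H^i(N/(W + rN))]; but
    [r] is zero on all of the cohomology of [N/W], by [kosz_homotopy]. *)
Lemma koszul_exact_step (W : N -> Prop) (a : I -> R) k :
  let r := \sum_(i <- l) a i * x i in
  submodule_pred W -> (forall v, W (r *: v) -> W v) ->
  koszul_exact (add_mult W r) k -> koszul_exact W k.+1.
Proof.
move=> r [W0 WD WZ] reg exact_k i c lt_ik supp_c Dc.
have WB u v : W u -> W v -> W (u - v).
  by move=> Wu Wv; apply: WD => //; rewrite -scaleN1r; apply: WZ.
have xB j : {morph (fun v : N => x j *: v) : u v / u - v}.
  by move=> u v; rewrite scalerBr.
pose h := contract a l c.
have rcE s : size s = size l -> r *: c s = D h s + contract a l (D c) s.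
  by move=> sz; rewrite kosz_homotopy.
have Whd s : size s = size l -> W (contract a l (D c) s).
  by move=> sz; apply: contract_sub => // t; rewrite sz; exact: Dc.
(* [h] contracts the cocycle [c]; modulo [W + rN] it is again a cocycle, in one
   degree less, hence a coboundary there.  In degree 0 there is nothing to
   contract. *)
have [b' hb'] : exists b', forall s, size s = size l ->
    add_mult W r (h s - D b' s).
  have addW v : W v -> add_mult W r v by exists v, 0; rewrite scaler0 addr0.
  case: i lt_ik supp_c => [_ supp_c|i lt_ik supp_c]; last first.
    apply: (exact_k i) => [//|s sz cs|s sz].
      apply: contract_eq0 => t st ct; apply: supp_c; first by rewrite st.
      by rewrite ct eqSS.
    exists (- contract a l (D c) s), (c s).
    split; last by rewrite rcE // addrC addrK.
    by rewrite -scaleN1r; apply/WZ/Whd.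
  exists (fun=> 0) => s sz; apply: addW.
  rewrite [h s]contract_eq0 ?sub0r; last first.
    by move=> t st ct; apply: supp_c; rewrite ?st ?ct.
  rewrite -(koszN xB); apply: (kosz_sub (W := W)) => // [j v|t _]; first exact: WZ.
  by rewrite oppr0.
(* Write [h = D b' + w + r e] with [w] in [W]; then [r c] and [r D e] agree modulo
   [W], and [r] can be cancelled. *)
pose P s (we : N * N) := W we.1 /\ h s - D b' s = we.1 + r *: we.2.
pose f s := epsilon (inhabits (0, 0)) (P s).
have fP s : size s = size l -> P s (f s).
  move=> sz; apply: (epsilon_spec (inhabits (0, 0)) (P s)).
  by have [w [e [Ww we]]] := hb' s sz; exists (w, e).
exists (fun s => (f s).2) => s sz; apply: reg.
have Dh : D h s = D (fun t => (f t).1) s + r *: D (fun t => (f t).2) s.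
  rewrite [r *: _](kosz_map (g := *:%R r) (g' := *:%R r) (P := N) (P' := N)
    (e := fun i v => x i *: v)).
  - rewrite -(koszD xB) -[LHS]subr0.
    rewrite -(kosz_kosz (f := fun i v => x i *: v) (f' := fun i v => x i *: v)
      l b' s xB xB).
      by rewrite -(koszB xB); apply: kosz_ext => t st _; exact: (fP t (etrans st sz)).2.
    by move=> j j' v; rewrite !scalerA mulrC.
  - by move=> u v; rewrite scalerBr.
  - by move=> j v; rewrite !scalerA mulrC.
rewrite scalerBr rcE // Dh addrAC addrK; apply: WD; last exact: Whd.
apply: (kosz_sub (W := W)) => // [j v|t st]; first exact: WZ.
exact: (fP t (etrans st sz)).1.
Qed.


End Grade.

Section RegularKoszul.
Variables (K : fieldType) (n : nat).
Local Notation S := {mpoly K[n]}.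
Variable N : lmodType S.

Lemma in_seq_mul_submodule (rs : seq S) : submodule_pred (@in_seq_mul _ _ N rs).
Proof.
split=> [|u v [f ->] [g ->]|p v [f ->]].
- by exists (fun=> 0); rewrite big1 // => i _; rewrite scaler0.
- exists (fun i => f i + g i); rewrite -big_split; apply: eq_bigr => i _.
  by rewrite scalerDr.
- exists (fun i => p *: f i); rewrite scaler_sumr; apply: eq_bigr => i _.
  by rewrite !scalerA mulrC.
Qed.

Lemma in_seq_mul_rcons (rs : seq S) r (v : N) :
  add_mult (in_seq_mul rs) r v <-> in_seq_mul (rcons rs r) v.
Proof.
rewrite /in_seq_mul size_rcons; split=> [[w [e [[f ->] ->]]]|[f ->]].
  exists (fun i => if (i < size rs)%N then f i else e).
  rewrite big_ord_recr /= ltnn nth_rcons ltnn eqxx; congr (_ + _).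
  by apply: eq_bigr => i _; rewrite nth_rcons ltn_ord.
exists (\sum_(i < size rs) rs`_i *: f i), (f (size rs)).
split; first by exists f.
rewrite big_ord_recr /= nth_rcons ltnn eqxx; congr (_ + _).
by apply: eq_bigr => i _; rewrite nth_rcons ltn_ord.
Qed.

Lemma maximal_ideal_span (p : S) : p@_0%MM = 0 ->
  exists a : 'I_n -> S, p = \sum_(i <- enum 'I_n) a i * 'X_i.
Proof.
move=> p0.
have XE (m : 'X_{1..n}) : m != 0%MM ->
    exists a : 'I_n -> S, 'X_[m] = \sum_(i <- enum 'I_n) a i * 'X_i.
  move=> m0; have [i mi] : exists i, m i != 0%N.
    apply/existsP; apply: contraNT m0 => /existsPn m0.
    by apply/eqP/mnmP => i; rewrite mnm0E; apply/eqP; have := m0 i; rewrite negbK.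
  exists (fun j => if j == i then 'X_[m - U_(i)] else 0).
  rewrite (bigD1_seq i) ?mem_enum ?enum_uniq //= eqxx big1 ?addr0.
    by rewrite -mpolyXD submK //; apply/mnm_lepP => j; rewrite mnm1E;
      case: eqP => [<-|//]; rewrite lt0n.
  by move=> j /negPf->; rewrite mul0r.
rewrite [p]mpolyE.
have : forall m, m \in msupp p -> m != 0%MM.
  by move=> m; apply: contraTneq => ->; rewrite mcoeff_msupp p0 eqxx.
elim: (msupp p : seq _) => [|m ms IHm] ms0.
  by exists (fun=> 0); rewrite big_nil big1 // => i _; rewrite mul0r.
have [|a aE] := IHm; first by move=> m' m'ms; apply: ms0; rewrite inE m'ms orbT.
have [|b bE] := XE m; first by apply: ms0; rewrite inE eqxx.
exists (fun i => p@_m *: b i + a i); rewrite big_cons aE bE scaler_sumr -big_split.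
by apply: eq_bigr => i _ /=; rewrite mulrDl scalerAl.
Qed.

Lemma eq_koszul_exact (W W' : N -> Prop) k : (forall v, W v <-> W' v) ->
  koszul_exact (fun i : 'I_n => 'X_i) (enum 'I_n) W k ->
  koszul_exact (fun i : 'I_n => 'X_i) (enum 'I_n) W' k.
Proof.
move=> WW ex i c lt_ik supp_c Dc.
have [|b bE] := ex i c lt_ik supp_c; first by move=> s /Dc; rewrite WW.
by exists b => s /bE; rewrite WW.
Qed.

(** Descending induction along the sequence: vanishing below degree 0 holds
    trivially for the quotient by the whole sequence, and each element removed
    from the end raises the range by one.  The elements need not be
    homogeneous. *)
Lemma regular_koszul_exact (rs : seq S) :
  {in rs, forall p, p@_0%MM = 0} -> @regular_sequence _ _ N rs ->
  koszul_exact (fun i : 'I_n => 'X_i) (enum 'I_n) (fun v : N => v = 0) (size rs).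
Proof.
move=> rs0 [reg _].
suff H j : (j <= size rs)%N -> koszul_exact (fun i : 'I_n => 'X_i) (enum 'I_n)
    (@in_seq_mul _ _ N (take (size rs - j) rs)) j.
  have := H _ (leqnn _); rewrite subnn take0; apply: eq_koszul_exact => v.
  by split=> [[w ->]|->]; [rewrite big_ord0 | exists (fun=> 0); rewrite big_ord0].
elim: j => [_ i c //|j IHj lt_j].
have lt_i : (size rs - j.+1 < size rs)%N by rewrite ltn_subrL (leq_trans _ lt_j).
have [a aE] := maximal_ideal_span (rs0 _ (mem_nth 0 lt_i)).
apply: (koszul_exact_step (a := a)).
- exact: in_seq_mul_submodule.
- by move=> v; rewrite -aE; apply: reg.
- rewrite -aE; have := IHj (ltnW lt_j); rewrite -[(size rs - j)%N](subnSK lt_j).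
  rewrite (take_nth 0) //; apply: eq_koszul_exact => v.
  by rewrite -in_seq_mul_rcons.
Qed.

End RegularKoszul.

(** * Graded modules given by matrices, and extension of scalars to K(t) *)

Section CommonDenominator.
Variable R : idomainType.
Local Notation "x %:F" := (tofrac x).

Lemma fracE (x : {fraction R}) : exists p q : R, q != 0 /\ q%:F * x = p%:F.
Proof.
elim/quotW: x => x; have d0 := denom_ratioP x.
exists (frac x).1, (frac x).2; split=> //.
unlock tofrac; rewrite -[LHS]FracField.pi_mul; apply/eqmodP => /=.
by rewrite FracField.equivfE /FracField.mulf !numden_Ratio ?mulr1 ?mul1r ?oner_neq0.
Qed.

Lemma common_denominator (L : seq {fraction R}) :
  exists2 q : R, q != 0 & forall x, x \in L -> exists p, q%:F * x = p%:F.
Proof.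
elim: L => [|x L [q q0 qE]]; first by exists 1; rewrite ?oner_neq0.
have [p' [q' [q'0 q'E]]] := fracE x.
exists (q * q'); first by rewrite mulf_neq0.
move=> y; rewrite inE tofracM => /predU1P[->|/qE[p pE]].
  by exists (q * p'); rewrite -mulrA q'E tofracM.
by exists (p * q'); rewrite mulrAC pE tofracM.
Qed.

End CommonDenominator.

Lemma mx_dim0 (R : nmodType) p m (v : 'M[R]_(p, m)) : m = 0%N -> v = 0.
Proof. by move=> m0; move: v; rewrite m0 => v; apply/matrixP=> i []. Qed.

(** A graded module over a polynomial ring, given by the dimensions [h e] of its
    pieces and the matrices [X i e] of the multiplications by the variables.  In
    this form, extension of scalars is [map_mx].  The pieces are numbered so that
    [h 0 = 0]. *)
Section GradedModel.
Variables (F : fieldType) (n : nat) (h : nat -> nat).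
Variable X : 'I_n -> forall e, 'M[F]_(h e, h e.+1).

Definition gkosz e (c : seq bool -> 'rV[F]_(h e)) : seq bool -> 'rV[F]_(h e.+1) :=
  kosz (fun i v => v *m X i e) (enum 'I_n) c.

(** Vanishing of the Koszul cohomology below degree [k].  Cochains valued in the
    piece 0 are zero, so only the pieces [e.+1] matter. *)
Definition gexact (k : nat) := forall i e (c : seq bool -> 'rV[F]_(h e.+1)),
  (i < k)%N ->
  (forall s, size s = n -> count id s != i -> c s = 0) ->
  (forall s, size s = n -> gkosz c s = 0) ->
  exists b : seq bool -> 'rV[F]_(h e), forall s, size s = n -> c s = gkosz b s.

Definition gcomm := forall i j e, X i e *m X j e.+1 = X j e *m X i e.+1.

Lemma mxB e i : {morph (fun v : 'rV_(h e) => v *m X i e) : u v / u - v}.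
Proof. by move=> u v; rewrite mulmxBl. Qed.

Lemma gkosz_gkosz e (c : seq bool -> 'rV[F]_(h e)) s : gcomm ->
  gkosz (gkosz c) s = 0.
Proof.
move=> XC; apply: kosz_kosz => [i|i|i j v]; try exact: mxB.
by rewrite -!mulmxA XC.
Qed.

(** [H^0] consists of the vectors killed by all variables. *)
Lemma gexact_socle e (v : 'rV[F]_(h e)) : gexact 1 -> h 0 = 0%N ->
  (forall i, v *m X i e = 0) -> v = 0.
Proof.
case: e v => [|e] v ex h0 vX.
  exact: mx_dim0.
pose c s := if count id s == 0%N then v else 0.
have [//|s sz cs|s sz|b bE] := ex 0%N e c.
- by rewrite /c (negPf cs).
- apply: (kosz_sub (W := fun u => forall i, u *m X i e.+1 = 0)
    (W' := fun u => u = 0)) => //.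
    by move=> u u' -> ->; rewrite subr0.
  by move=> t _ i; rewrite /c; case: eqP => // _; rewrite mul0mx.
have /= := bE (nseq n false); rewrite size_nseq /c count_nseq mul0n eqxx => -> //.
rewrite -[RHS](kosz0 (@mxB e) (enum 'I_n) (nseq n false)).
by apply: kosz_ext => t _; rewrite count_nseq.
Qed.

End GradedModel.

Lemma kosz_sum I (M M' : zmodType) (f : I -> M -> M') l s J (r : seq J)
    (c : J -> seq bool -> M) :
  (forall i, {morph f i : u v / u - v}) ->
  kosz f l (fun t => \sum_(j <- r) c j t) s = \sum_(j <- r) kosz f l (c j) s.
Proof.
move=> fB; elim: r => [|j r IHr].
  rewrite big_nil -[RHS](kosz0 fB l s).
  by apply: kosz_ext => t; rewrite big_nil.
rewrite big_cons -IHr -(koszD fB).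
by apply: kosz_ext => t; rewrite big_cons.
Qed.

Section BaseChange.
Variables (F : fieldType) (n : nat) (h : nat -> nat).
Variable X : 'I_n -> forall e, 'M[F]_(h e, h e.+1).
Local Notation T := {fraction {poly F}}.
Local Notation "x %:F" := (tofrac x).

Definition Xpoly i e : 'M[{poly F}]_(h e, h e.+1) := map_mx polyC (X i e).
Definition Xfrac i e : 'M[T]_(h e, h e.+1) := map_mx (@tofrac _) (Xpoly i e).

Lemma tofrac_mx_inj p m : injective (map_mx (@tofrac {poly F}) : 'M_(p, m) -> _).
Proof.
move=> u v /matrixP uv; apply/matrixP => i j; have := uv i j.
by rewrite !mxE => /eqP; rewrite tofrac_eq => /eqP.
Qed.


Lemma clear_denominators m (r : seq (seq bool)) (c : seq bool -> 'rV[T]_m) :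
  exists2 q : {poly F}, q != 0 & exists p : seq bool -> 'rV[{poly F}]_m,
    forall s, s \in r -> q%:F *: c s = map_mx (@tofrac _) (p s).
Proof.
have [q q0 qE] := common_denominator [seq c s 0 j | s <- r, j <- enum 'I_m].
exists q => //.
pose P (x : T) (y : {poly F}) := q%:F * x = y%:F.
exists (fun s => \row_j epsilon (inhabits 0) (P (c s 0 j))) => s sr.
apply/rowP => j; rewrite !mxE.
apply: (epsilon_spec (inhabits 0) (P (c s 0 j))); apply: qE.
by apply/allpairsP; exists (s, j); rewrite mem_enum.
Qed.

Lemma coef_mul_Xpoly i e m (v : 'rV_(h e)) :
  map_mx (coefp m) (v *m Xpoly i e) = map_mx (coefp m) v *m X i e.
Proof.
apply/rowP => j; rewrite !mxE raddf_sum; apply: eq_bigr => l _.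
by rewrite !mxE /= coefMC.
Qed.

(** After clearing denominators, a cocycle over [F(t)] has polynomial entries; as
    the matrices have entries in [F], the coefficients of each power of [t] form a
    cocycle over [F], which bounds. *)
Lemma gexact_frac k : gexact X k -> gexact Xfrac k.
Proof.
move=> ex i e c lt_ik supp_c Dc.
pose r := [seq val t | t <- enum {: n.-tuple bool}].
have rP s : (s \in r) = (size s == n).
  apply/mapP/idP => [[t _ ->]|sz]; first by rewrite size_tuple.
  by exists (Tuple sz); rewrite ?mem_enum.
have [q q0 [p pE]] := clear_denominators r c.
have qF0 : q%:F != 0 by rewrite tofrac_eq0.
have supp_p s : size s = n -> count id s != i -> p s = 0.
  move=> sz cs; apply: tofrac_mx_inj.
  by rewrite -pE ?rP ?sz // supp_c // scaler0 map_mx0.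
have Dp s : size s = n ->
    kosz (fun j v => v *m Xpoly j e.+1) (enum 'I_n) p s = 0.
  move=> sz; apply: tofrac_mx_inj; rewrite map_mx0 -[RHS](scaler0 _ q%:F) -(Dc s) //.
  rewrite /gkosz.
  rewrite (kosz_map (g := map_mx (@tofrac _)) (g' := map_mx (@tofrac _))
    (e := fun j v => v *m Xfrac j e.+1)); last 2 first.
  - by move=> u v; rewrite map_mxB.
  - by move=> j v; rewrite map_mxM.
  rewrite (kosz_map (g := *:%R q%:F) (g' := *:%R q%:F) (P' := 'rV[T]_(h e.+2))
    (e := fun j v => v *m Xfrac j e.+1)); last 2 first.
  - by move=> u v; rewrite scalerBr.
  - by move=> j v; rewrite scalemxAl.
  by apply: kosz_ext => t st _ /=; rewrite pE // rP st sz.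
have exb m : exists b : seq bool -> 'rV[F]_(h e),
    forall s, size s = n -> map_mx (coefp m) (p s) = gkosz X b s.
  apply: (ex i) => // s sz; first by move=> cs; rewrite supp_p // map_mx0.
  rewrite /gkosz -[RHS](map_mx0 (coefp m)) -(Dp s) //.
  apply/esym/kosz_map => [u v|j v]; first by rewrite map_mxB.
  exact: coef_mul_Xpoly.
pose b m := sval (constructive_indefinite_description _ (exb m)).
have bE m s : size s = n -> map_mx (coefp m) (p s) = gkosz X (b m) s.
  by move=> sz; rewrite /b; case: constructive_indefinite_description => /= ? ->.
pose M := \max_(t : n.-tuple bool) \max_(j < h e.+1) size (p t ord0 j).
exists (fun s => \sum_(m < M) (('X^m)%:F / q%:F) *:
           map_mx (@tofrac _) (map_mx polyC (b m s))) => s sz.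
rewrite /gkosz kosz_sum; last by move=> j; exact: mxB.
under eq_bigr => m _.
  rewrite -(kosz_map (f := fun j v => v *m X j e) (P := 'rV[T]_(h e))
      (P' := 'rV[T]_(h e.+1))
    (g := fun v => (('X^m)%:F / q%:F) *: map_mx (@tofrac _) (map_mx polyC v))
    (g' := fun v => (('X^m)%:F / q%:F) *: map_mx (@tofrac _) (map_mx polyC v)));
  first over.
  - by move=> u v; rewrite !map_mxB scalerBr.
  - by move=> j v; rewrite !map_mxM scalemxAl.
apply: (scalerI qF0); rewrite pE ?rP ?sz // scaler_sumr.
apply/rowP => j; rewrite mxE summxE.
have sizep : (size (p s ord0 j) <= M)%N.
  have sz' : size s == n by rewrite sz.
  rewrite /M (bigD1 (Tuple sz')) //= leq_max; apply/orP; left.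
  by rewrite (bigD1 j) //= leq_max leqnn.
have -> : p s 0 j = \sum_(m < M) 'X^m * ((p s 0 j)`_m)%:P.
  apply/polyP => d; rewrite coef_sum.
  under eq_bigr do rewrite coefMC coefXn.
  have [ltdM|leMd] := ltnP d M; last first.
    rewrite nth_default ?(leq_trans sizep) // big1 // => m _.
    by rewrite gtn_eqF ?mul0r // (leq_trans (ltn_ord m)).
  rewrite (bigD1 (Ordinal ltdM)) //= eqxx mul1r big1 ?addr0 // => m.
  by rewrite -val_eqE /= eq_sym => /negPf->; rewrite mul0r.
rewrite rmorph_sum; apply: eq_bigr => m _.
have /rowP/(_ j) := bE m s sz; rewrite mxE /= => pmE.
by rewrite rmorphM /= pmE ![in RHS]mxE mulrA [q%:F * _]mulrC divfK.
Qed.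

End BaseChange.

(** * A generic linear form is a nonzerodivisor *)

Section McCoy.
Variables (F : fieldType) (n : nat) (h : nat -> nat).
Variable X : 'I_n -> forall e, 'M[F]_(h e, h e.+1).
Hypotheses (XC : gcomm X)
  (socle0 : forall e (v : 'rV[F]_(h e)), (forall i, v *m X i e = 0) -> v = 0).
Local Notation T := {fraction {poly F}}.
Local Notation "x %:F" := (tofrac x).

Definition lin_poly e : 'M[{poly F}]_(h e, h e.+1) :=
  \sum_(i < n) 'X^i *: Xpoly X i e.

Definition lin_frac e : 'M[T]_(h e, h e.+1) := map_mx (@tofrac _) (lin_poly e).

Lemma gcomm_poly i j e : Xpoly X i e *m Xpoly X j e.+1 = Xpoly X j e *m Xpoly X i e.+1.
Proof. by rewrite -!map_mxM XC. Qed.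

Lemma gcomm_frac : gcomm (Xfrac X).
Proof. by move=> i j e; rewrite -!map_mxM XC. Qed.

Lemma lin_poly_comm i e : lin_poly e *m Xpoly X i e.+1 = Xpoly X i e *m lin_poly e.+1.
Proof.
rewrite mulmx_suml mulmx_sumr; apply: eq_bigr => j _.
by rewrite -scalemxAl -scalemxAr gcomm_poly.
Qed.

Lemma lin_frac_comm i e : lin_frac e *m Xfrac X i e.+1 = Xfrac X i e *m lin_frac e.+1.
Proof. by rewrite -!map_mxM lin_poly_comm. Qed.

(** McCoy's argument.  Let [L = \sum_i t^i x_i] kill [g], of degree at most [m] in
    [t].  Going down from the last variable, suppose that [x_s g = 0] for all
    [s > i].  The coefficient of [t^(m + i)] in [L g] is then that of [t^m] in
    [x_i g], so [x_i g], again killed by [L], has smaller degree in [t] and is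
    zero by induction.  Hence all variables kill [g], and so do they kill its
    coefficients, which vanish because the socle is zero. *)
Lemma lin_poly_inj m e (g : 'rV[{poly F}]_(h e)) :
  (forall j, (size (g ord0 j) <= m)%N) -> g *m lin_poly e = 0 -> g = 0.
Proof.
elim: m e g => [|m IHm] e g sz gL.
  by apply/rowP => j; apply/eqP; rewrite !mxE -size_poly_leq0.
suff gX0 i : g *m Xpoly X i e = 0.
  apply/rowP => j; rewrite mxE; apply/polyP => d; rewrite coef0.
  have /rowP/(_ j) : map_mx (coefp d) g = 0.
    apply: socle0 => i; rewrite -coef_mul_Xpoly gX0.
    by apply/rowP => l; rewrite !mxE /= coef0.
  by rewrite !mxE.
have szX i' l : (size ((g *m Xpoly X i' e) ord0 l) <= m.+1)%N.
  rewrite mxE (leq_trans (size_sum _ _ _)) //; apply/bigmax_leqP => d _.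
  by rewrite mxE mulrC mul_polyC (leq_trans (size_scale_leq _ _)).
have [k] := ubnP (n - i); elim: k i => // k IHk i ltk.
apply: (IHm e.+1); last first.
  by rewrite -mulmxA -lin_poly_comm mulmxA gL mul0mx.
move=> l; apply/leq_sizeP => d; rewrite leq_eqVlt => /predU1P[<-|ltmd]; last first.
  by rewrite nth_default // (leq_trans (szX _ _)).
have /rowP/(_ l) := gL; rewrite mulmx_sumr summxE mxE => /polyP/(_ (m + i)%N).
rewrite coef0 coef_sum (bigD1 i) //= -scalemxAr mxE coefXnM.
rewrite ltnNge leq_addl /= addnK big1 ?addr0 // => i' i'i.
rewrite -scalemxAr mxE coefXnM; case: ltnP => // le_i'.
case: (ltngtP i' i) => [lti|gti|/val_inj eqi]; last by rewrite eqi eqxx in i'i.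
  rewrite nth_default // (leq_trans (szX _ _)) //.
  by rewrite -addnBA ?(ltnW lti) // -[m.+1]addn1 leq_add2l subn_gt0.
rewrite IHk ?mxE ?coef0 // -ltnS (leq_trans _ ltk) // ltnS ltn_sub2l //.
Qed.

Lemma lin_frac_free e : row_free (lin_frac e).
Proof.
rewrite -kermx_eq0; apply/rowV0P => v /sub_kermxP vL.
have [q q0 [p pE]] := clear_denominators [:: [::]] (fun=> v).
have {}pE := pE [::] (mem_head _ _).
have p0 : p [::] = 0.
  apply: (@lin_poly_inj (\max_j size (p [::] ord0 j)) e) => [j|].
    exact: (leq_bigmax (F := fun j => size (p [::] ord0 j))).
  by apply: tofrac_mx_inj; rewrite map_mxM -pE -scalemxAl vL scaler0 map_mx0.
move: pE; rewrite p0 map_mx0 => /eqP; rewrite scaler_eq0 tofrac_eq0 (negPf q0).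
by move/eqP.
Qed.

End McCoy.

(** * Dividing by an injective linear form *)

Section Quotient.
Variables (F : fieldType) (n : nat) (h : nat -> nat).
Variable X : 'I_n -> forall e, 'M[F]_(h e, h e.+1).
Variable L : forall e, 'M[F]_(h e, h e.+1).
Hypotheses (XC : gcomm X) (h0 : h 0 = 0%N)
  (LX : forall i e, L e *m X i e.+1 = X i e *m L e.+1)
  (Lfree : forall e, row_free (L e)).

Definition hquot e := if e is e'.+1 then \rank (cokermx (L e')) else 0%N.

(** The projection onto the cokernel of [L] in the piece [e], in coordinates: the
    columns of [cokermx] span the linear forms that vanish on the image, and
    [col_base] selects a basis of them. *)
Definition proj_quot e : 'M[F]_(h e, hquot e) :=
  if e is e'.+1 then col_base (cokermx (L e')) else 0.

Definition Xquot i e : 'M[F]_(hquot e, hquot e.+1) :=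
  pinvmx (proj_quot e) *m X i e *m proj_quot e.+1.

Lemma hquotE e : (hquot e.+1 + h e = h e.+1)%N.
Proof.
by rewrite /= mxrank_coker (eqP (Lfree e)) subnK // -(eqP (Lfree e)) rank_leq_col.
Qed.

Lemma proj_quot_full e : row_full (proj_quot e).
Proof.
by case: e => [|e] /=; [rewrite -col_leq_rank leq0n | exact: col_base_full].
Qed.

Lemma proj_quotK p e (u : 'M_(p, hquot e)) : u *m pinvmx (proj_quot e) *m proj_quot e = u.
Proof. by rewrite -mulmxA mulVpmx ?mulmx1 // proj_quot_full. Qed.

Lemma mul_proj_quot e : L e *m proj_quot e.+1 = 0.
Proof.
apply: (row_free_inj (row_base_free (cokermx (L e)))).
by rewrite -mulmxA mulmx_base mulmx_coker mul0mx.
Qed.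

Lemma proj_quot_eq0 p e (v : 'M_(p, h e.+1)) : v *m proj_quot e.+1 = 0 -> (v <= L e)%MS.
Proof. by move=> v0; rewrite submxE -[cokermx _]mulmx_base mulmxA v0 mul0mx. Qed.

Lemma proj_quotX i p e (v : 'M_(p, h e)) :
  v *m proj_quot e *m Xquot i e = v *m X i e *m proj_quot e.+1.
Proof.
rewrite /Xquot (mulmxA _ _ (proj_quot e.+1)) (mulmxA _ _ (X i e)).
apply/eqP; rewrite -subr_eq0 -!mulmxBl; apply/eqP.
set u := _ - v; have u0 : u *m proj_quot e = 0.
  by rewrite /u mulmxBl proj_quotK subrr.
move: (u) u0; clear u; case: e v => [|e] _ u u0.
  by rewrite [u]mx_dim0 // !mul0mx.
have /submxP[w ->] := proj_quot_eq0 u0.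
by rewrite -(mulmxA w) LX (mulmxA w) -(mulmxA (w *m _)) mul_proj_quot mulmx0.
Qed.

Lemma gcomm_quot : gcomm Xquot.
Proof.
move=> i j e; set P := proj_quot e.
have PK a : pinvmx P *m X a e *m proj_quot e.+1 = Xquot a e by [].
by rewrite -(PK i) -(PK j) !proj_quotX -!(mulmxA (pinvmx P)) XC.
Qed.

(** The long exact cohomology sequence of [0 -> N -> N -> N/LN -> 0]: a cocycle of
    the quotient lifts to [c] with [D c = L a]; then [a] is a cocycle one degree
    higher, bounds some [b], and [c - L b] is a cocycle of [N], hence bounds. *)
Lemma gexact_quot k : gexact X k.+1 -> gexact Xquot k.
Proof.
move=> ex i e c' lt_ik supp_c' Dc'.
pose c s := c' s *m pinvmx (proj_quot e.+1).
have cK s : c s *m proj_quot e.+1 = c' s by rewrite proj_quotK.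
have supp_c s : size s = n -> count id s != i -> c s = 0.
  by move=> sz cs; rewrite /c supp_c' ?mul0mx.
have DP d (a : seq bool -> 'rV_(h d)) s :
    gkosz X a s *m proj_quot d.+1 = gkosz Xquot (fun t => a t *m proj_quot d) s.
  apply: (kosz_map (g := mulmx^~ (proj_quot d)) (g' := mulmx^~ (proj_quot d.+1))).
    by move=> u v; rewrite mulmxBl.
  by move=> j v; rewrite proj_quotX.
have DL d (a : seq bool -> 'rV_(h d)) s :
    gkosz X a s *m L d.+1 = gkosz X (fun t => a t *m L d) s.
  apply: (kosz_map (g := mulmx^~ (L d)) (g' := mulmx^~ (L d.+1))).
    by move=> u v; rewrite mulmxBl.
  by move=> j v; rewrite -!mulmxA LX.
pose a s := gkosz X c s *m pinvmx (L e.+1).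
have aL s : size s = n -> a s *m L e.+1 = gkosz X c s.
  move=> sz; apply: mulmxKpV; apply: proj_quot_eq0.
  by rewrite DP -(Dc' s sz); apply: kosz_ext => t _ _; rewrite cK.
have Dc0 s : size s = n -> count id s != i.+1 -> gkosz X c s = 0.
  move=> sz cs; rewrite -(kosz0 (@mxB _ _ _ X e.+1) (enum 'I_n) s).
  apply: kosz_ext => t st ct; rewrite supp_c ?st //.
  by apply: contraNneq cs => <-; rewrite ct.
have [//|s sz cs|s sz|b bE] := ex i.+1 e a.
- by rewrite /a Dc0 ?mul0mx.
- apply: (row_free_inj (Lfree _)); rewrite DL mul0mx -(gkosz_gkosz c s XC).
  by apply: kosz_ext => t st _; rewrite aL ?st.
(* Only the part of [b] in degree [i] contributes to its coboundary [a], which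
   lives in degree [i.+1]; without this truncation [c - L b] would not be
   homogeneous. *)
pose b' s := if count id s == i then b s else 0.
have b'E s : size s = n -> gkosz X b' s = a s.
  move=> sz; have [cs|cs] := eqVneq (count id s) i.+1.
    rewrite bE //; apply: kosz_ext => t st ct; rewrite /b' ifT //.
    by rewrite -eqSS ct cs.
  rewrite /a Dc0 // mul0mx -(kosz0 (@mxB _ _ _ X e) (enum 'I_n) s).
  apply: kosz_ext => t st ct; rewrite /b' ifN //.
  by apply: contraNneq cs => <-; rewrite ct.
have [||s sz|w wE] := ex i e (fun s => c s - b' s *m L e); first exact: ltnW.
- by move=> s sz cs; rewrite supp_c // /b' (negPf cs) mul0mx subr0.
- rewrite /gkosz (koszB (@mxB _ _ _ X e.+1)).
  by rewrite -/(gkosz X _ s) -/(gkosz X _ s) -DL b'E // aL // subrr.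
exists (fun s => w s *m proj_quot e) => s sz.
by rewrite -DP -wE // mulmxBl cK -mulmxA mul_proj_quot mulmx0 subr0.
Qed.

End Quotient.

(** Multiplication of the generating series by [1 - t]. *)
Definition diff (f : nat -> int) (e : nat) : int :=
  f e - (if e is e'.+1 then f e' else 0).

Lemma eq_diffs k f g : f =1 g -> iter k diff f =1 iter k diff g.
Proof.
move=> fg; elim: k => [|k IHk] //= e; rewrite /diff IHk.
by case: e => // e; rewrite IHk.
Qed.

(** Each step replaces the field by its field of rational functions and the module
    by its quotient by the generic linear form; the dimensions are thereby replaced
    by their differences. *)
Lemma gexact_diff_ge0 k (F : fieldType) n (h : nat -> nat)
    (X : 'I_n -> forall e, 'M[F]_(h e, h e.+1)) :
  gcomm X -> h 0 = 0%N -> gexact X k ->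
  forall e, (0 <= iter k diff (fun d => (h d)%:Z) e)%R.
Proof.
elim: k F h X => [|k IHk] F h X XC h0 ex e //.
have socle e' (v : 'rV[F]_(h e')) : (forall i, v *m X i e' = 0) -> v = 0.
  apply: gexact_socle => // i e'' c; rewrite ltnS leqn0 => /eqP->.
  exact: ex.
rewrite iterSr.
have LX := lin_frac_comm XC; have Lfree := lin_frac_free XC socle.
have := IHk _ _ _ (gcomm_quot (gcomm_frac XC) h0 LX) (erefl _)
  (gexact_quot (gcomm_frac XC) h0 LX Lfree (gexact_frac ex)) e.
rewrite (@eq_diffs k _ (diff (fun d => (h d)%:Z))) // => -[|d] /=.
  by rewrite /diff h0.
by move: (hquotE Lfree d) => /= hE; rewrite /diff -[h d.+1 in RHS]hE PoszD addrK.
Qed.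

(** * Homogeneous components of a graded module *)

Section Grading.
Variables (K : fieldType) (n : nat).
Local Notation S := {mpoly K[n]}.
Variables (N : lmodType S) (gr : int -> N -> Prop).
Hypothesis grN : is_grading gr.

Lemma gr_scale d (c : K) v : gr d v -> gr d (c%:MP *: v).
Proof.
move=> gv; rewrite -[d]add0r; apply: (gradingZ grN) => //.
by rewrite -[c%:MP]mulr1 mul_mpolyC; apply: dhomogZ; exact: dhomog1.
Qed.

Lemma gr_sub d u v : gr d u -> gr d v -> gr d (u - v).
Proof.
move=> gu gv; apply: (gradingD grN) => //.
by rewrite -scaleN1r -(rmorphN1 (@mpolyC n K)); exact: gr_scale.
Qed.

Lemma gr_sum d J (r : seq J) (P : pred J) (f : J -> N) :
  (forall j, P j -> gr d (f j)) -> gr d (\sum_(j <- r | P j) f j).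
Proof.
by move=> gf; elim/big_ind: _ => //; [exact: grading0 | exact: gradingD].
Qed.

Definition decomposes (v : N) (f : int -> N) :=
  (forall d, gr d (f d)) /\
  exists s : seq int, [/\ uniq s, forall d, d \notin s -> f d = 0 &
    v = \sum_(d <- s) f d].

Lemma decomposes_ex v : exists f, decomposes v f.
Proof.
have [s [f [us gf vE]]] := grading_sum grN v.
exists (fun d => if d \in s then f d else 0); split.
  by move=> d; case: ifP => // _; exact: grading0.
exists s; split=> // [d /negPf-> //|].
by rewrite vE; apply: eq_big_seq => d ->.
Qed.

Lemma big_widen (f : int -> N) (s s' : seq int) :
  uniq s -> uniq s' -> {subset s <= s'} -> (forall d, d \notin s -> f d = 0) ->
  \sum_(d <- s) f d = \sum_(d <- s') f d.
Proof.
move=> us us' ss' f0; rewrite [RHS](bigID (mem s)) /= [X in _ + X]big1 ?addr0.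
  rewrite -[RHS]big_filter; apply: perm_big; apply: uniq_perm => //.
    by rewrite filter_uniq.
  by move=> d; rewrite mem_filter; case: (boolP (d \in s)) => // /ss' ->.
by move=> d /f0.
Qed.

Lemma decomposesB u v f g : decomposes u f -> decomposes v g ->
  decomposes (u - v) (fun d => f d - g d).
Proof.
move=> [gf [s [us sf uE]]] [gg [t [ut tg vE]]]; split.
  by move=> d; exact: gr_sub.
exists (undup (s ++ t)); split; first exact: undup_uniq.
  by move=> d; rewrite mem_undup mem_cat negb_or => /andP[/sf-> /tg->]; rewrite subr0.
rewrite uE vE (@big_widen f s (undup (s ++ t))) ?undup_uniq //; last first.
  by move=> d ds; rewrite mem_undup mem_cat ds.
rewrite (@big_widen g t (undup (s ++ t))) ?undup_uniq //; last first.
  by move=> d ds; rewrite mem_undup mem_cat ds orbT.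
by rewrite -sumrB.
Qed.

Lemma decomposes_uniq v f g d : decomposes v f -> decomposes v g -> f d = g d.
Proof.
move=> vf vg; have [gfg [s [us sfg]]] := decomposesB vf vg.
rewrite subrr => /esym fg0; apply/eqP; rewrite -subr_eq0; apply/eqP.
have [ds|/sfg//] := boolP (d \in s).
exact: (grading_direct grN us gfg fg0).
Qed.

(** The axioms of a grading provide decompositions into homogeneous parts that are
    unique up to zero terms; as a family indexed by all degrees the decomposition
    is unique, hence additive in [v]. *)
Definition component (d : int) (v : N) : N :=
  epsilon (inhabits (fun=> 0)) (decomposes v) d.

Lemma componentE v f d : decomposes v f -> component d v = f d.
Proof.
move=> vf; apply: decomposes_uniq vf.
exact: (epsilon_spec (inhabits (fun=> 0)) (decomposes v) (decomposes_ex v)).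
Qed.

Lemma decomposes_component v : decomposes v (component^~ v).
Proof.
exact: (epsilon_spec (inhabits (fun=> 0)) (decomposes v) (decomposes_ex v)).
Qed.

Lemma component_gr d v : gr d (component d v).
Proof. exact: (decomposes_component v).1. Qed.

Lemma componentB d : {morph component d : u v / u - v}.
Proof.
move=> u v; apply: (componentE (f := fun d => component d u - component d v)).
by apply: decomposesB; exact: decomposes_component.
Qed.

Lemma component0 d : component d 0 = 0.
Proof. by have := componentB d 0 0; rewrite !subrr. Qed.

Lemma componentD d : {morph component d : u v / u + v}.
Proof.
move=> u v; rewrite -[v in LHS]opprK componentB -[- v in LHS]sub0r.
by rewrite componentB component0 sub0r opprK.
Qed.

Lemma component_id d v : gr d v -> component d v = v.
Proof.
move=> gv; rewrite (@componentE v (fun d' => if d' == d then v else 0)) ?eqxx //.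
split; first by move=> d'; case: eqP => [->|_] //; exact: grading0.
by exists [:: d]; split=> // [d'|]; rewrite ?big_seq1 ?eqxx // inE => /negPf->.
Qed.

Lemma componentZ (e : nat) d (p : S) v : p \is e.-homog ->
  component (e%:Z + d) (p *: v) = p *: component d v.
Proof.
move=> hp; rewrite (@componentE _ (fun d' => p *: component (d' - e%:Z) v)).
  by rewrite [e%:Z + d]addrC addrK.
have [_ [s [us sv vE]]] := decomposes_component v; split.
  move=> d'; rewrite -{1}[d'](subrK e%:Z) addrC.
  by apply: (gradingZ grN) => //; exact: component_gr.
exists [seq e%:Z + d' | d' <- s]; split.
- by rewrite map_inj_uniq //; exact: addrI.
- move=> d' d's; rewrite sv ?scaler0 //; apply: contra d's => d's.
  by apply/mapP; exists (d' - e%:Z); rewrite // addrC subrK.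
- rewrite big_map {1}vE scaler_sumr; apply: eq_bigr => d' _.
  by rewrite [e%:Z + _]addrC addrK.
Qed.

(** A bound beyond which all components vanish, in the shape needed for products
    with monomials of degree [m]. *)
Lemma component_finite v : exists B : nat,
  forall d (m : nat), (`|d| + B < m)%N -> component (d - m%:Z) v = 0.
Proof.
have [_ [s [us sv _]]] := decomposes_component v.
exists (\sum_(d <- s) `|d|)%N => d m ltm; apply: sv; apply: contraTN ltm => ds.
rewrite -leqNgt (big_rem _ ds) /= addnA; apply: leq_trans (leq_addr _ _).
by have := leqD_dist d 0 (d - m%:Z); rewrite subKr subr0 sub0r abszN.
Qed.

End Grading.

(** * Dimensions, and finiteness of the components *)

Section Dimension.
Variables (K : fieldType) (n : nat).
Local Notation S := {mpoly K[n]}.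
Variable N : lmodType S.

Definition lincomb r (b : 'I_r -> N) (c : 'I_r -> K) : N :=
  \sum_(i < r) (c i)%:MP *: b i.

Lemma eq_lincomb r (b : 'I_r -> N) c c' : c =1 c' -> lincomb b c = lincomb b c'.
Proof. by move=> cc'; apply: eq_bigr => i _; rewrite cc'. Qed.

Lemma lincomb_ffun r (b : 'I_r -> N) (c : 'I_r -> K) :
  lincomb b (finfun c) = lincomb b c.
Proof. by apply: eq_lincomb => i; rewrite ffunE. Qed.

Lemma lincombB r (b : 'I_r -> N) c c' :
  lincomb b (fun i => c i - c' i) = lincomb b c - lincomb b c'.
Proof. by rewrite -sumrB; apply: eq_bigr => i _; rewrite mpolyCB scalerBl. Qed.

Lemma lincombZ r (b : 'I_r -> N) a c :
  lincomb b (fun i => a * c i) = a%:MP *: lincomb b c.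
Proof. by rewrite scaler_sumr; apply: eq_bigr => i _; rewrite mpolyCM scalerA. Qed.

Lemma lincomb_sum r (b : 'I_r -> N) J (s : seq J) (c : J -> 'I_r -> K) :
  lincomb b (fun i => \sum_(j <- s) c j i) = \sum_(j <- s) lincomb b (c j).
Proof.
rewrite exchange_big; apply: eq_bigr => i _ /=.
by rewrite rmorph_sum scaler_suml.
Qed.

Lemma lincomb_delta r (b : 'I_r -> N) i : lincomb b (fun j => (j == i)%:R) = b i.
Proof.
rewrite /lincomb (bigD1 i) //= eqxx mpolyC1 scale1r big1 ?addr0 // => j /negPf->.
by rewrite mpolyC0 scale0r.
Qed.

Definition is_basis (W : N -> Prop) r (b : 'I_r -> N) :=
  [/\ forall c, W (lincomb b c), forall v, W v -> exists c, v = lincomb b c &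
      forall c, lincomb b c = 0 -> c =1 (fun=> 0)].

Lemma has_dimP (W : N -> Prop) r :
  has_dim W r <-> exists b : 'I_r -> N, is_basis W b.
Proof.
split=> [[b [Wb bW]]|[b [Wb bW b0]]]; exists b.
- split=> [c|v /bW[c [-> _]]|c c0 i].
  + by rewrite -lincomb_ffun; exact: Wb.
  + by exists c.
  + have W0 : W 0.
      rewrite -(_ : lincomb b (fun=> 0) = 0).
        by rewrite -lincomb_ffun; exact: Wb.
      by apply: big1 => j _; rewrite mpolyC0 scale0r.
    have [c' [_ c'U]] := bW 0 W0.
    have c'0 : c' = [ffun=> 0].
      by apply: c'U; rewrite big1 // => j _; rewrite ffunE mpolyC0 scale0r.
    have : c' = finfun c.
      exact/c'U/(etrans (esym c0))/(esym (lincomb_ffun b c)).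
    by rewrite c'0 => /ffunP/(_ i); rewrite !ffunE.
- split=> [c|v /bW[c vE]]; first exact: Wb.
  exists (finfun c); split; first by rewrite vE -lincomb_ffun.
  move=> c' c'E; apply/ffunP => i; rewrite ffunE; apply/eqP; rewrite -subr_eq0.
  by rewrite (b0 (fun i => c i - c' i)) // lincombB -vE -[X in _ - X]c'E subrr.
Qed.

Lemma has_dim_leq (W : N -> Prop) r r' : has_dim W r -> has_dim W r' -> (r <= r')%N.
Proof.
rewrite !has_dimP => -[b [Wb _ b0]] [b' [_ bW' _]].
pose P i (c : 'rV[K]_r') := b i = lincomb b' (c ord0).
have PE i : P i (epsilon (inhabits 0) (P i)).
  apply: (epsilon_spec (inhabits 0) (P i)).
  have [|c cE] := bW' (b i); first by rewrite -(lincomb_delta b i); exact: Wb.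
  by exists (\row_j c j); rewrite /P cE; apply: eq_lincomb => j; rewrite mxE.
pose A : 'M[K]_(r, r') := \matrix_(i, j) epsilon (inhabits 0) (P i) ord0 j.
suff /eqP <- : row_free A by exact: rank_leq_col.
rewrite -kermx_eq0; apply/rowV0P => u /sub_kermxP uA.
apply/rowP => i; rewrite mxE; apply: (b0 (u ord0)).
have -> : lincomb b (u ord0) = lincomb b' ((u *m A) ord0).
  rewrite [RHS](@eq_lincomb _ b' _ (fun j => \sum_(i <- enum 'I_r) u ord0 i * A i j)).
    rewrite lincomb_sum /lincomb big_enum /=; apply: eq_bigr => k _.
    rewrite [X in _ *: X](PE k) -lincombZ.
    by apply: eq_lincomb => j; rewrite mxE.
  by move=> j; rewrite mxE big_enum.
by rewrite uA /lincomb big1 // => j _; rewrite mxE mpolyC0 scale0r.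
Qed.

Lemma has_dim_inj (W : N -> Prop) r r' : has_dim W r -> has_dim W r' -> r = r'.
Proof. by move=> Wr Wr'; apply/eqP; rewrite eqn_leq !(@has_dim_leq W). Qed.

(** A dependent spanning family stays spanning when a vector with a nonzero
    coefficient in the relation is dropped. *)
Lemma has_dim_span (W : N -> Prop) r (b : 'I_r -> N) :
  (forall c, W (lincomb b c)) -> (forall v, W v -> exists c, v = lincomb b c) ->
  exists r', has_dim W r'.
Proof.
elim: r b => [|r IHr] b Wb bW.
  by exists 0%N; apply/has_dimP; exists b; split=> // c _ [].
case: (classic (forall c, lincomb b c = 0 -> c =1 (fun=> 0))) => [indep|].
  by exists r.+1; apply/has_dimP; exists b.
move=> dep; have [c dep_c] := not_all_ex_not _ _ dep.
have [c0 dep_c0] := imply_to_and _ _ dep_c.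
have [i ci] := not_all_ex_not _ _ dep_c0.
have {}ci : c i != 0 by apply/eqP.
have liftE c' : lincomb (b \o lift i) (c' \o lift i) = lincomb b c' - (c' i)%:MP *: b i.
  by rewrite /lincomb [in RHS](bigD1_ord i) //= addrAC subrr add0r.
apply: (IHr (b \o lift i)) => [c'|v /bW[c' ->]].
  pose c'' j := if unlift i j is Some k then c' k else 0.
  have -> : lincomb (b \o lift i) c' = lincomb b c''; last exact: Wb.
  have c''i : c'' i = 0 by rewrite /c'' unlift_none.
  rewrite -[RHS]subr0 -(scale0r (b i)) -(mpolyC0 n K) -c''i -liftE.
  by apply: eq_lincomb => j; rewrite /= /c'' liftK.
exists ((fun j => c' j - c' i / c i * c j) \o lift i).
rewrite liftE lincombB lincombZ c0 scaler0 subr0 divfK // subrr.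
by rewrite mpolyC0 scale0r subr0.
Qed.

End Dimension.

Section FiniteDimension.
Variables (K : fieldType) (n : nat).
Local Notation S := {mpoly K[n]}.
Variable N : lmodType S.

Lemma has_dim_span_fin (W : N -> Prop) (J : finType) (b : J -> N) :
  (forall c : J -> K, W (\sum_j (c j)%:MP *: b j)) ->
  (forall v, W v -> exists c : J -> K, v = \sum_j (c j)%:MP *: b j) ->
  exists r, has_dim W r.
Proof.
move=> Wb bW; apply: (@has_dim_span _ _ _ _ #|J| (b \o enum_val)) => [c|v /bW[c ->]].
  have := Wb (c \o enum_rank); rewrite (reindex _ (onW_bij _ (enum_val_bij J))) /=.
  by under eq_bigr do rewrite enum_valK.
by exists (c \o enum_val); rewrite (reindex _ (onW_bij _ (enum_val_bij J))).
Qed.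

Variable gr : int -> N -> Prop.
Hypotheses (grN : is_grading gr) (fgN : finitely_generated N).

(** The degree [d] part is spanned by the products of a monomial with a component
    of a generator, in complementary degrees; finitely many of them are
    nonzero. *)
Lemma gr_has_dim d : has_dim (gr d) (hilbert_function gr d).
Proof.
apply: (epsilon_spec (inhabits 0%N) (has_dim (gr d))).
have [k [g gE]] := fgN.
have exB i : exists B : nat, forall d (m : nat), (`|d| + B < m)%N ->
  component gr (d - m%:Z) (g i) = 0 by exact: component_finite.
pose B i := sval (constructive_indefinite_description _ (exB i)).
have BE i m : (`|d| + B i < m)%N -> component gr (d - m%:Z) (g i) = 0.
  by rewrite /B; case: constructive_indefinite_description => /= ? BE; exact: BE.
pose M := (`|d| + \sum_i B i).+1.
pose b (j : 'I_k * 'X_{1..n < M}) : N :=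
  'X_[j.2] *: component gr (d - (mdeg j.2)%:Z) (g j.1).
have gb j : gr d (b j).
  rewrite /b -[d in X in gr X _](subrK (mdeg j.2)%:Z) addrC.
  by apply: (gradingZ grN); [rewrite dhomogX | exact: component_gr].
apply: (has_dim_span_fin (b := b)) => [c|v gv].
  by apply: gr_sum => // j _; apply: gr_scale.
pose sp (u : N) := exists c : 'I_k * 'X_{1..n < M} -> K, u = \sum_j (c j)%:MP *: b j.
have sp0 : sp 0.
  by exists (fun=> 0); rewrite big1 // => j _; rewrite mpolyC0 scale0r.
have spD u w : sp u -> sp w -> sp (u + w).
  move=> [c ->] [c' ->]; exists (fun j => c j + c' j); rewrite -big_split.
  by apply: eq_bigr => j _; rewrite mpolyCD scalerDl.
have spZ (a : K) u : sp u -> sp (a%:MP *: u).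
  move=> [c ->]; exists (fun j => a * c j); rewrite scaler_sumr.
  by apply: eq_bigr => j _; rewrite mpolyCM scalerA.
have spb j : sp (b j).
  exists (fun j' => (j' == j)%:R); rewrite (bigD1 j) //= eqxx mpolyC1 scale1r.
  by rewrite big1 ?addr0 // => j' /negPf->; rewrite mpolyC0 scale0r.
have compS J (r : seq J) (f : J -> N) :
    component gr d (\sum_(j <- r) f j) = \sum_(j <- r) component gr d (f j).
  by apply: (big_morph _ (componentD grN d) (component0 grN d)).
rewrite -/(sp v) -(component_id grN gv).
have [c ->] := gE v; rewrite compS; apply: (big_ind sp) => // i _.
rewrite [c i]mpolyE scaler_suml compS; apply: (big_ind sp) => // m _.
rewrite -mul_mpolyC -scalerA -[d in component _ d _]add0r -[0]/(0%N%:Z).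
rewrite componentZ //; last by rewrite -[_%:MP]mulr1 mul_mpolyC dhomogZ // dhomog1.
apply: spZ; rewrite -[d](subrK (mdeg m)%:Z) addrC componentZ ?dhomogX //.
have [ltm|leM] := ltnP (mdeg m) M; first exact: (spb (i, BMultinom ltm)).
rewrite BE ?scaler0 // (leq_trans _ leM) // ltnS leq_add2l.
by rewrite (bigD1 i) //= leq_addr.
Qed.

End FiniteDimension.

(** * Depth forces nonnegative differences *)

Section Model.
Variables (K : fieldType) (n : nat).
Local Notation S := {mpoly K[n]}.
Variables (N : lmodType S) (gr : int -> N -> Prop).
Hypotheses (grN : is_grading gr) (fgN : finitely_generated N).

(** The piece numbered [e] is the component of degree [e - 1], so that the piece 0
    is the zero component of degree -1. *)
Definition hshift (e : nat) : nat := hilbert_function gr (e%:Z - 1).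

Lemma basis_ex e : exists b : 'I_(hshift e) -> N, is_basis (gr (e%:Z - 1)) b.
Proof. by apply/has_dimP; exact: gr_has_dim. Qed.

Definition basis e := sval (constructive_indefinite_description _ (basis_ex e)).

Lemma basisP e : is_basis (gr (e%:Z - 1)) (@basis e).
Proof. by rewrite /basis; case: constructive_indefinite_description. Qed.

Definition of_coord e (v : 'rV[K]_(hshift e)) : N := lincomb (@basis e) (v ord0).

Definition coord e (u : N) : 'rV[K]_(hshift e) :=
  epsilon (inhabits 0) (fun v => of_coord v = u).

Lemma coordK e u : gr (e%:Z - 1) u -> of_coord (coord e u) = u.
Proof.
move=> gu; apply: (epsilon_spec (inhabits 0) (fun v => of_coord v = u)).
have [_ bW _] := basisP e; have [c ->] := bW u gu.
by exists (\row_j c j); apply: eq_lincomb => j; rewrite mxE.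
Qed.

Lemma of_coord_gr e v : gr (e%:Z - 1) (@of_coord e v).
Proof. by have [Wb _ _] := basisP e; exact: Wb. Qed.

Lemma of_coordB e : {morph @of_coord e : u v / u - v}.
Proof. by move=> u v; rewrite -lincombB; apply: eq_lincomb => j; rewrite !mxE. Qed.

Lemma of_coord0 e : @of_coord e 0 = 0.
Proof. by have := of_coordB (0 : 'rV_(hshift e)) 0; rewrite !subrr. Qed.

Lemma of_coord_inj e : injective (@of_coord e).
Proof.
move=> u v /eqP; rewrite -subr_eq0 -of_coordB => /eqP.
have [_ _ b0] := basisP e; move/b0 => uv.
by apply/rowP => j; apply/eqP; have := uv j; rewrite !mxE -subr_eq0 => ->.
Qed.

Definition Xmodel (i : 'I_n) e : 'M[K]_(hshift e, hshift e.+1) :=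
  \matrix_(r, j) coord e.+1 ('X_i *: basis r) ord0 j.

Lemma gr_mulX i e u : gr (e%:Z - 1) u -> gr (e.+1%:Z - 1) ('X_i *: u).
Proof.
move=> gu; rewrite -addn1 PoszD [e%:Z + _]addrC -addrA.
by apply: (gradingZ grN) => //; rewrite dhomogX /= mdeg1.
Qed.

Lemma Xmodel_of_coord i e v : of_coord (v *m Xmodel i e) = 'X_i *: of_coord v.
Proof.
rewrite /of_coord {2}/lincomb scaler_sumr.
have br r : gr (e%:Z - 1) (@basis e r).
  by rewrite -(lincomb_delta (@basis e)); have [Wb _ _] := basisP e; exact: Wb.
transitivity (\sum_r (v ord0 r)%:MP *: of_coord (coord e.+1 ('X_i *: @basis e r))).
  rewrite -big_enum /=; under [RHS]eq_bigr do rewrite -lincombZ.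
  rewrite -lincomb_sum; apply: eq_lincomb => j; rewrite mxE big_enum.
  by apply: eq_bigr => r _; rewrite mxE.
apply: eq_bigr => r _; rewrite coordK; last exact/gr_mulX.
by rewrite !scalerA mulrC.
Qed.

Lemma gcomm_model : gcomm Xmodel.
Proof.
move=> i j e; apply/row_matrixP => r; rewrite !rowE !mulmxA.
apply: of_coord_inj; rewrite !Xmodel_of_coord !scalerA.
by rewrite mulrC.
Qed.

(** A homogeneous cocycle that is a coboundary is the coboundary of the homogeneous
    component of a primitive. *)
Lemma gexact_model k :
  koszul_exact (fun i : 'I_n => 'X_i) (enum 'I_n) (fun v : N => v = 0) k ->
  gexact Xmodel k.
Proof.
move=> ex i e c lt_ik supp_c Dc.
have enumn (s : seq bool) : (size s = size (enum 'I_n)) <-> (size s = n) by rewrite size_enum_ord.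
have DX d (a : seq bool -> 'rV_(hshift d)) s :
    of_coord (gkosz Xmodel a s) =
    kosz (fun i v => 'X_i *: v) (enum 'I_n) (@of_coord d \o a) s.
  by apply: kosz_map => [|j v]; [exact: of_coordB | exact: Xmodel_of_coord].
have [//|s /enumn sz cs|s /enumn sz|b bE] := ex i (@of_coord e.+1 \o c).
- by rewrite /= supp_c // of_coord0.
- by rewrite -DX Dc // of_coord0.
exists (fun s => coord e (component gr (e%:Z - 1) (b s))) => s sz.
apply: of_coord_inj; rewrite DX.
have := bE s ((enumn s).2 sz); move/eqP; rewrite subr_eq0 => /eqP /= cE.
rewrite -(component_id grN (of_coord_gr (c s))) cE.
rewrite (kosz_map (g := component gr (e%:Z - 1))
  (g' := component gr (e.+1%:Z - 1)) (e := fun i v => 'X_i *: v)).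
- by apply: kosz_ext => t _ _ /=; rewrite coordK //; exact: component_gr.
- exact: componentB.
- move=> j v; rewrite -(componentZ grN (e := 1%N)) ?dhomogX /= ?mdeg1 //.
  by rewrite addrA -PoszD.
Qed.

End Model.

Lemma diffs_delay (f g : nat -> int) k e : f 0%N = 0 -> (forall d, f d.+1 = g d) ->
  iter k diff f e.+1 = iter k diff g e.
Proof.
move=> f0 fg; suff [] : iter k diff f 0%N = 0 /\
    forall e, iter k diff f e.+1 = iter k diff g e by [].
elim: k => [//|k [IH0 IHk]] /=; split=> [|[|d]]; rewrite /diff.
- by rewrite IH0 subr0.
- by rewrite IHk IH0.
- by rewrite !IHk.
Qed.

Theorem regular_diff_ge0 (K : fieldType) (n : nat) (N : lmodType {mpoly K[n]})
    (gr : int -> N -> Prop) (rs : seq {mpoly K[n]}) :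
  is_grading gr -> finitely_generated N -> hilbert_function gr (-1) = 0%N ->
  {in rs, forall p, p@_0%MM = 0} -> @regular_sequence _ _ N rs ->
  forall e, (0 <= iter (size rs) diff (fun d => (hilbert_function gr d%:Z)%:Z) e)%R.
Proof.
move=> grN fgN h0 rs0 reg e.
rewrite -(@diffs_delay (fun e => (hshift gr e)%:Z)); last 2 first.
- by rewrite /hshift sub0r h0.
- by move=> d; rewrite /hshift -addn1 PoszD addrK.
apply: (gexact_diff_ge0 (gcomm_model grN fgN)); first by rewrite /hshift sub0r h0.
by apply: gexact_model; exact: regular_koszul_exact.
Qed.

(** * Hilbert functions of squarefree monomial modules *)

(** Multiplication of the generating series by [t^i]. *)
Definition shift (i : nat) (f : nat -> int) (e : nat) : int :=
  if (i <= e)%N then f (e - i)%N else 0.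

Lemma diff_shift i f e : diff (shift i f) e = shift i (diff f) e.
Proof.
case: e => [|e].
  by rewrite /diff /shift subr0; case: i => [|i] //=; rewrite subr0.
rewrite /diff /shift; have [le_ie|lt_ei] := leqP i e.
  by rewrite leqW // subSn.
rewrite subr0; have [le_ie1|//] := leqP i e.+1.
by have -> : i = e.+1; [apply/eqP; rewrite eqn_leq le_ie1 | rewrite subnn subr0].
Qed.

Lemma diffD f g e : diff (fun d => f d + g d) e = diff f e + diff g e.
Proof. by rewrite /diff; case: e => [|e]; rewrite ?subr0 // opprD addrACA. Qed.

Lemma diff_inj f g : diff f =1 diff g -> f =1 g.
Proof.
move=> fg; elim=> [|e IHe]; first by have := fg 0%N; rewrite /diff !subr0.
by have := fg e.+1; rewrite /diff IHe => /addIr.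
Qed.

Lemma diffs_inj k f g : iter k diff f =1 iter k diff g -> f =1 g.
Proof. by elim: k => // k IHk fg; apply/IHk/diff_inj => e; exact: fg. Qed.

Lemma diffs_sum k J (r : seq J) (a : J -> int) (f : J -> nat -> int) e :
  iter k diff (fun d => \sum_(j <- r) a j * f j d) e =
  \sum_(j <- r) a j * iter k diff (f j) e.
Proof.
elim: k e => // k IHk e; rewrite /= /diff.
case: e => [|e]; rewrite !IHk.
  by rewrite subr0; apply: eq_bigr => j _; rewrite subr0.
by rewrite -sumrB; apply: eq_bigr => j _; rewrite mulrBr.
Qed.

Fixpoint exponents (n d : nat) : seq (seq nat) :=
  if n is n'.+1 then [seq c :: x | c <- iota 0 d.+1, x <- exponents n' (d - c)]
  else if d == 0%N then [:: [::]] else [::].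

Lemma exponentsS n d :
  exponents n.+1 d = [seq c :: x | c <- iota 0 d.+1, x <- exponents n (d - c)].
Proof. by []. Qed.

Lemma mem_exponents n d x : (x \in exponents n d) = (size x == n) && (sumn x == d).
Proof.
elim: n d x => [|n IHn] d x.
  by rewrite /=; case: eqP => [->|]; case: x => //= d0; rewrite ?inE //; apply/esym/eqP => /esym.
rewrite exponentsS; apply/allpairsPdep/idP => [[c [y]]|].
  rewrite mem_iota add0n IHn => -[/= lecd /andP[/eqP <- /eqP sy] ->] /=.
  by rewrite sy subnKC ?eqxx.
case: x => // c x; rewrite [size _]/= [sumn _]/= eqSS => /andP[sx /eqP <-].
by exists c, x; rewrite mem_iota IHn sx ltnS leq_addr addKn eqxx.
Qed.

Lemma exponents_uniq n d : uniq (exponents n d).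
Proof.
elim: n d => [|n IHn] d; first by rewrite /=; case: eqP.
rewrite exponentsS; apply: allpairs_uniq_dep => [|c _|]; rewrite ?iota_uniq ?IHn //.
by move=> [c x] [c' x'] _ _ /= [-> ->].
Qed.

Lemma count_exponentsS P n d :
  count P (exponents n.+1 d) =
  (\sum_(c < d.+1) count (P \o cons (c : nat)) (exponents n (d - c)))%N.
Proof.
rewrite exponentsS count_flatten -map_comp sumnE big_map -[iota 0 _]/(index_iota 0 d.+1).
by rewrite big_mkord; apply: eq_bigr => c _ /=; rewrite count_map.
Qed.

(** The Hilbert function of a polynomial ring in [a] variables, with generating
    series [1 / (1 - t)^a]. *)
Definition poly_hf (a e : nat) : int := (size (exponents a e))%:Z.

Lemma poly_hf0 e : poly_hf 0 e = (e == 0%N)%:Z.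
Proof. by rewrite /poly_hf /=; case: eqP. Qed.

Lemma diff_conv (f : nat -> nat) d :
  diff (fun d => (\sum_(c < d.+1) f (d - c))%N%:Z) d = (f d)%:Z.
Proof.
case: d => [|d]; rewrite /diff; first by rewrite big_ord1 subr0.
by rewrite big_ord_recl PoszD addrK.
Qed.

Lemma diff_poly_hf a e : diff (poly_hf a.+1) e = poly_hf a e.
Proof.
rewrite -[RHS](diff_conv (fun d => size (exponents a d))).
apply: (@eq_diffs 1) => d.
by rewrite /poly_hf -count_predT count_exponentsS; under eq_bigr do rewrite count_predT.
Qed.

Lemma diffs_poly_hf k a e : iter k diff (poly_hf (k + a)) e = poly_hf a e.
Proof.
elim: k a e => // k IHk a e; rewrite iterSr -(IHk a).
by apply: eq_diffs => d; rewrite addSn diff_poly_hf.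
Qed.

Lemma diffs_shift k i f e : iter k diff (shift i f) e = shift i (iter k diff f) e.
Proof.
elim: k e => // k IHk e; rewrite -diff_shift -[RHS]/(iter 1 diff _ _).
by rewrite [iter k.+1 _ _]iterS; apply: (@eq_diffs 1) => d; exact: IHk.
Qed.

(** The number of monomials of degree [e] whose support is a given set of [j]
    variables: dividing by the product of these variables leaves an arbitrary
    monomial in them. *)
Definition face_hf (j : nat) : nat -> int := shift j (poly_hf j).

(** The number of bit lists of length [n] with [j] bits set that satisfy [phi]; for
    a simplicial complex, an entry of its face vector.  The recursion separates the
    faces that avoid the first vertex from those that contain it. *)
Fixpoint fcount (n : nat) (phi : seq bool -> bool) (j : nat) : nat :=
  if n is n'.+1 then
    fcount n' (phi \o cons false) j +
    (if j is j'.+1 then fcount n' (phi \o cons true) j' else 0)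
  else (j == 0) && phi [::].

Lemma fcountS n phi j : fcount n.+1 phi j =
  (fcount n (phi \o cons false) j +
   if j is j'.+1 then fcount n (phi \o cons true) j' else 0)%N.
Proof. by []. Qed.

Lemma fcount_gt n phi j : (n < j)%N -> fcount n phi j = 0%N.
Proof.
elim: n phi j => [|n IHn] phi [|j] //= ltnj; rewrite !IHn //.
exact: ltnW.
Qed.

Lemma eq_fcount n phi phi' : phi =1 phi' -> fcount n phi =1 fcount n phi'.
Proof.
elim: n phi phi' => [|n IHn] phi phi' ee j /=; first by rewrite ee.
rewrite (IHn (phi \o cons false) (phi' \o cons false)) => [|s]; last exact: ee.
case: j => // j; congr (_ + _)%N.
by apply: (IHn (phi \o cons true) (phi' \o cons true)) => s; exact: ee.
Qed.

Lemma fcountC n phi j : (fcount n (negb \o phi) j + fcount n phi j)%N = 'C(n, j).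
Proof.
elim: n phi j => [|n IHn] phi [|j] /=.
- by rewrite bin0; case: (phi [::]).
- by rewrite bin0n.
- by rewrite !addn0 -[RHS](bin0 n) -(IHn (phi \o cons false)).
- by rewrite binS -(IHn (phi \o cons false)) -(IHn (phi \o cons true)) addnACA.
Qed.

Lemma diff_face_hf j e : diff (face_hf j.+1) e = shift 1 (face_hf j) e.
Proof.
rewrite /face_hf diff_shift /shift; case: e => [|e] //=.
by rewrite ltnS subSS diff_poly_hf subn1.
Qed.

(** Monomials are grouped by their support; [map (leq 1)] turns an exponent vector
    into its support. *)
Lemma count_supp n phi d :
  (count (phi \o map (leq 1)) (exponents n d))%:Z =
  \sum_(j <- iota 0 n.+1) (fcount n phi j)%:Z * face_hf j d.
Proof.
elim: n phi d => [|n IHn] phi d.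
  rewrite big_seq1 /face_hf /shift subn0 /poly_hf /=.
  by case: eqP => //= _; rewrite ?mulr0 // addn0 mulr1.
pose f psi e := (count (psi \o map (leq 1)) (exponents n e))%:Z.
move: d; apply: diff_inj => d.
transitivity (diff (f (phi \o cons false)) d + shift 1 (f (phi \o cons true)) d).
  pose G e := (\sum_(c < e.+1)
    count ((phi \o cons true) \o map (leq 1)) (exponents n (e - c)))%N%:Z.
  have fE e : (count (phi \o map (leq 1)) (exponents n.+1 e))%:Z =
      f (phi \o cons false) e + shift 1 G e.
    rewrite count_exponentsS big_ord_recl PoszD subn0; congr (_ + _).
    case: e => [|e]; rewrite /shift ?big_ord0 //= subn1 /=; congr Posz.
  rewrite [LHS](@eq_diffs 1 _ _ fE) /= diffD diff_shift; congr (_ + _).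
  rewrite /shift; case: ifP => // _.
  exact: (diff_conv (fun e => count ((phi \o cons true) \o map (leq 1)) (exponents n e))).
have -> : diff (f (phi \o cons false)) d =
    \sum_(j <- iota 0 n.+1) (fcount n (phi \o cons false) j)%:Z * diff (face_hf j) d.
  rewrite -[RHS](@diffs_sum 1 _ _ _ face_hf); apply: (@eq_diffs 1) => e.
  exact: IHn.
have -> : shift 1 (f (phi \o cons true)) d =
    \sum_(j <- iota 0 n.+1) (fcount n (phi \o cons true) j)%:Z * diff (face_hf j.+1) d.
  rewrite /shift; case: ltnP => [d0|d0]; last first.
    by rewrite big1 // => j _; rewrite diff_face_hf /shift ltnNge d0 mulr0.
  by rewrite /f IHn; apply: eq_bigr => j _; rewrite diff_face_hf /shift d0.
rewrite [RHS](@diffs_sum 1 _ _ (fun j => (fcount n.+1 phi j)%:Z) face_hf) [iter 1 _]/=.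
under [RHS]eq_bigr => j _ do rewrite fcountS PoszD mulrDl.
rewrite [RHS]big_split; congr (_ + _).
  by rewrite -[n.+2]addn1 iotaD big_cat big_seq1 /= fcount_gt // mul0r addr0.
rewrite -[n.+2]/(1 + n.+1)%N iotaD big_cat big_seq1 mul0r.
by rewrite [RHS]add0r (iotaDl 1 0) big_map.
Qed.

(** * Decomposition into polynomial rings *)

Definition hseries (a : nat -> nat) (n e : nat) : int :=
  \sum_(j <- iota 0 n.+1) (a j)%:Z * face_hf j e.

(** The coefficient of [t^e] in the polynomial
    [\sum_(j <= k) a_j t^j (1 - t)^(k - j)]. *)
Definition beta (a : nat -> nat) (k e : nat) : int :=
  \sum_(j <- iota 0 k.+1) (a j)%:Z * iter (k - j) diff (shift j (poly_hf 0)) e.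

Lemma diffs_face_hf k j e : (j <= k)%N ->
  iter k diff (face_hf j) e = iter (k - j) diff (shift j (poly_hf 0)) e.
Proof.
move=> le_jk; rewrite -{1}(subnK le_jk) iterD; apply: eq_diffs => d.
rewrite diffs_shift /shift; case: ifP => // _; rewrite -{2}[j]addn0; exact: diffs_poly_hf.
Qed.

Lemma diffs_face_hf_low k j e : (e <= k)%N -> (k < j)%N -> iter k diff (face_hf j) e = 0.
Proof. by move=> le_ek ltkj; rewrite diffs_shift /shift leqNgt (leq_ltn_trans le_ek). Qed.

Lemma diffs_supp k f b e : (forall d, (b < d)%N -> f d = 0) -> (b + k < e)%N ->
  iter k diff f e = 0.
Proof.
move=> f0; elim: k e => [|k IHk] e lt_e /=; first by apply: f0; rewrite -(addn0 b).
case: e lt_e => // e; rewrite addnS ltnS => lt_e.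
by rewrite /diff !IHk ?subr0 // (leq_trans lt_e).
Qed.

Lemma shift_poly_hf0 i e : shift i (poly_hf 0) e = (e == i)%:Z.
Proof.
rewrite /shift poly_hf0; case: leqP => [le|lt]; last by rewrite ltn_eqF.
by rewrite subn_eq0 eqn_leq le andbT.
Qed.

Lemma diffs_shift_poly_hf0_supp k j e : (j <= k)%N -> (k < e)%N ->
  iter (k - j) diff (shift j (poly_hf 0)) e = 0.
Proof.
move=> le_jk lt_ke; apply: (@diffs_supp _ _ j); last by rewrite subnKC.
by move=> d lt_jd; rewrite shift_poly_hf0 gtn_eqF.
Qed.

Lemma beta_supp a k e : (k < e)%N -> beta a k e = 0.
Proof.
move=> lt_ke; rewrite /beta big_seq big1 // => j; rewrite mem_iota add0n ltnS /=.
by move=> le_jk; rewrite diffs_shift_poly_hf0_supp ?mulr0.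
Qed.

Lemma hseries_split a n k e : (k <= n)%N -> hseries a n e =
  \sum_(j <- iota 0 k.+1) (a j)%:Z * face_hf j e +
  \sum_(j <- iota k.+1 (n - k)) (a j)%:Z * face_hf j e.
Proof. by move=> le_kn; rewrite -big_cat -iotaD addSn subnKC. Qed.

(** Up to degree [k] the faces with more than [k] elements do not contribute to the
    [k]-th difference. *)
Lemma beta_diffs a n k e : (k <= n)%N -> (e <= k)%N ->
  iter k diff (hseries a n) e = beta a k e.
Proof.
move=> le_kn le_ek; rewrite (@diffs_sum k _ _ _ face_hf).
rewrite -(subnKC le_kn) -addSn iotaD big_cat -[RHS]addr0; congr (_ + _).
  rewrite /beta [LHS]big_seq [RHS]big_seq; apply: eq_bigr => j.
  by rewrite mem_iota add0n ltnS /= => le_jk; rewrite diffs_face_hf.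
rewrite big_seq big1 // => j; rewrite mem_iota add0n => /andP[lt_kj _].
by rewrite diffs_face_hf_low ?mulr0.
Qed.

(** The part with [j <= k] equals the polynomial with coefficients [beta a k] over
    [(1 - t)^k].  Both sides have the same [k]-th difference. *)
Lemma hseries_decomp a n k e : (k <= n)%N -> hseries a n e =
  \sum_(i <- iota 0 k.+1) beta a k i * shift i (poly_hf k) e +
  \sum_(j <- iota k.+1 (n - k)) (a j)%:Z * face_hf j e.
Proof.
move=> le_kn; rewrite (hseries_split _ _ le_kn); congr (_ + _).
move: e; apply: (@diffs_inj k) => e.
rewrite (@diffs_sum k _ _ _ face_hf) (@diffs_sum k _ _ _ (fun i => shift i (poly_hf k))).
transitivity (beta a k e).
  rewrite /beta [LHS]big_seq [RHS]big_seq; apply: eq_bigr => j.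
  by rewrite mem_iota add0n ltnS /= => le_jk; rewrite diffs_face_hf.
have dM i : iter k diff (shift i (poly_hf k)) e = (e == i)%:Z.
  rewrite diffs_shift -shift_poly_hf0 /shift; case: ifP => // _.
  by rewrite -{2}[k]addn0 diffs_poly_hf.
under eq_bigr do rewrite dM.
have [lt_ke|le_ek] := ltnP k e.
  rewrite beta_supp // big_seq big1 // => i; rewrite mem_iota add0n ltnS => /= le_ik.
  by rewrite gtn_eqF ?mulr0 // (leq_ltn_trans le_ik).
rewrite (bigD1_seq e) ?iota_uniq ?mem_iota //= eqxx mulr1 big1 ?addr0 // => i.
by rewrite eq_sym => /negPf->; rewrite mulr0.
Qed.

(** If [k > b], the series multiplied by [(1 - t)^(k - 1)] is a polynomial of degree
    at most [k - 1]; let [f] be the sequence of its coefficients.  Since [diff f]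
    is nonnegative, [f] is nonnegative and nondecreasing, hence zero, and so is
    the series. *)
Lemma diffs_ge0_bound a n b k : (forall j, (b < j)%N -> a j = 0%N) ->
  (forall e, (0 <= iter k diff (hseries a n) e)%R) ->
  (exists e, hseries a n e != 0) -> (k <= b)%N.
Proof.
move=> a0 ge0 [e0 nz]; rewrite leqNgt; apply: contra nz => lt_bk.
case: k lt_bk ge0 => // k; rewrite ltnS => le_bk ge0.
pose f := iter k diff (hseries a n).
have f0 e : (k < e)%N -> f e = 0.
  move=> lt_ke; rewrite /f (@diffs_sum k _ _ _ face_hf) big1 // => j _.
  have [le_jb|/a0->] := leqP j b; last by rewrite mul0r.
  by rewrite diffs_face_hf ?diffs_shift_poly_hf0_supp ?mulr0 // (leq_trans le_jb).
have f_mono e : (0 <= f e)%R /\ (f e <= f e.+1)%R.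
  have fS d : (f d <= f d.+1)%R.
    by have := ge0 d.+1; rewrite iterS /diff Num.Theory.subr_ge0.
  split=> //; elim: e => [|e IHe]; last exact: Order.POrderTheory.le_trans (fS e).
  by have := ge0 0%N; rewrite iterS /diff subr0.
have fz e : f e = 0.
  apply/eqP; rewrite Order.POrderTheory.eq_le (f_mono e).1 andbT.
  rewrite -(f0 (e + k.+1)%N) ?leq_addl //.
  elim: k.+1 => [|m IHm]; first by rewrite addn0.
  by apply: Order.POrderTheory.le_trans IHm _; rewrite addnS; have [] := f_mono (e + m)%N.
rewrite (_ : hseries a n e0 = 0) //.
have z0 : iter k diff (fun=> 0) =1 (fun=> 0).
  by elim: (k) => // m IHm e; rewrite /= /diff; case: e => [|e]; rewrite !IHm.
by apply: (@diffs_inj k _ (fun=> 0)) => e; rewrite z0; exact: fz.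
Qed.

(** * The inequalities for complexes on at most five vertices *)

Definition fvector n psi := [seq fcount n psi j | j <- iota 0 n.+1].

(** The face vector of a complex from those of the deletion and the link of a
    vertex. *)
Definition glue_fvector n (v1 v2 : seq nat) : seq nat :=
  [seq (nth 0 v1 j + (if j is j'.+1 then nth 0 v2 j' else 0))%N | j <- iota 0 n.+2].

(** A list containing the face vectors of all complexes on [n] vertices, including
    the void one.  Of the inclusion of the link in the deletion only the inequality
    of face numbers is kept: this may let in vectors that belong to no complex, but
    spares the enumeration of the complexes. *)
Fixpoint fvectors n : seq (seq nat) :=
  if n is n'.+1 then
    let c := fvectors n' in
    undup [seq glue_fvector n' v w | v <- c, w <- [seq w <- c | all2 leq w v]]
  else [:: [:: 1%N]; [:: 0%N]].

(** [psi] defines a simplicial complex on [n] vertices. *)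
Definition antitone n (psi : seq bool -> bool) :=
  forall s t, size s = n -> all2 implb s t -> psi t -> psi s.

Lemma leq_fcount n (phi psi : seq bool -> bool) j :
  (forall s, size s = n -> phi s -> psi s) -> (fcount n phi j <= fcount n psi j)%N.
Proof.
elim: n phi psi j => [|n IHn] phi psi j le.
  by have := le [::] erefl; rewrite /= => /implyP; case: eqP => //; do 2!case: (_ [::]).
rewrite !fcountS leq_add ?IHn //; first by move=> s sz; apply: le; rewrite /= sz.
by case: j => // j; apply: IHn => s sz; apply: le; rewrite /= sz.
Qed.

Lemma nth_fvector n psi j : nth 0%N (fvector n psi) j = fcount n psi j.
Proof.
have [lt|ge] := ltnP j n.+1; first by rewrite (nth_map 0%N) ?size_iota // nth_iota.
by rewrite nth_default ?size_map ?size_iota // fcount_gt.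
Qed.

Lemma fvectorsP n psi : antitone n psi -> fvector n psi \in fvectors n.
Proof.
elim: n psi => [|n IHn] psi anti; first by rewrite /fvector /=; case: (psi [::]).
have antib b : antitone n (psi \o cons b).
  by move=> s t sz st; apply: anti; rewrite /= ?sz // st andbT implybb.
rewrite mem_undup; apply/allpairsPdep.
exists (fvector n (psi \o cons false)), (fvector n (psi \o cons true)); split.
- exact: IHn (antib false).
- rewrite mem_filter IHn // andbT /fvector.
  elim: (iota 0 n.+1) => //= j r ->; rewrite andbT; apply: leq_fcount => s sz.
  apply: anti; rewrite /= ?sz //.
  by elim: (s) => //= b s' ->; rewrite implybb.
- apply: eq_map => j; rewrite fcountS !nth_fvector.
  by case: j => // j; rewrite nth_fvector.
Qed.

Fixpoint sumz (s : seq int) : int := if s is x :: s' then x + sumz s' else 0.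

(** A form of [beta] that evaluates, big operators being opaque to computation. *)
Definition betaz (v : seq nat) k e : int :=
  sumz [seq (nth 0%N v j)%:Z * iter (k - j) diff (fun d => (d == j)%:Z) e
       | j <- iota 0 k.+1].

Definition beta_ge0 (v : seq nat) k : bool :=
  all (fun e => if betaz v k e is Posz _ then true else false) (iota 0 k.+1).

Definition complement_vector n (v : seq nat) :=
  [seq ('C(n, j) - nth 0 v j)%N | j <- iota 0 n.+1].

(** The vectors tested are those of complexes that contain the empty face and not
    the full simplex. *)
Definition hdepth_check n : bool :=
  all (fun v => if (nth 0 v 0 == 1)%N && (nth 0 v n == 0)%N then
       all (fun k => if beta_ge0 v k then
              beta_ge0 (complement_vector n v) k.+1 else true) (iota 0 n)
     else true) (fvectors n).

Lemma betazE v k e : betaz v k e = beta (nth 0%N v) k e.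
Proof.
rewrite /betaz /beta; elim: (iota 0 k.+1) => [|j r IHr]; first by rewrite big_nil.
rewrite big_cons -IHr /=; congr (_ * _ + _); apply: eq_diffs => d.
by rewrite shift_poly_hf0.
Qed.

Lemma beta_ge0P v k :
  reflect (forall e, (e <= k)%N -> (0 <= beta (nth 0%N v) k e)%R) (beta_ge0 v k).
Proof.
apply: (iffP allP) => [ge0 e le_ek|ge0 e].
  have := ge0 e; rewrite mem_iota add0n ltnS betazE => /(_ le_ek).
  by case: (beta _ k e).
by rewrite mem_iota add0n ltnS betazE => /ge0; case: (beta _ k e).
Qed.

Lemma hdepth_check_le5 n : (n <= 5)%N -> hdepth_check n.
Proof.
by case: n => [|[|[|[|[|[|n]]]]]] // _; vm_compute.
Qed.

Lemma eq_beta a a' k e : a =1 a' -> beta a k e = beta a' k e.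
Proof. by move=> aa; apply: eq_bigr => j _; rewrite aa. Qed.

(** The combinatorial content of the theorem: [psi] is the complex of the
    squarefree monomials outside the ideal, its negation the set of those
    inside. *)
Theorem beta_complement n psi k : (n <= 5)%N -> antitone n psi ->
  fcount n psi 0 = 1%N -> fcount n psi n = 0%N -> (k < n)%N ->
  (forall e, (e <= k)%N -> (0 <= beta (fcount n psi) k e)%R) ->
  forall e, (e <= k.+1)%N -> (0 <= beta (fcount n (negb \o psi)) k.+1 e)%R.
Proof.
move=> le5 anti f0 fn lt_kn ge0 e le_e.
have /allP/(_ _ (fvectorsP anti)) /= := hdepth_check_le5 le5.
rewrite !nth_fvector f0 fn !eqxx /= => /allP/(_ k).
rewrite mem_iota lt_kn => /(_ isT); case: ifP => [_|/beta_ge0P[]]; last first.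
  by move=> d le_d; rewrite (eq_beta _ _ (nth_fvector n psi)) ge0.
move=> /beta_ge0P/(_ e le_e); congr (is_true (_ <= _)%R); apply: eq_beta => j.
have [lt|ge] := ltnP j n.+1; last first.
  by rewrite fcount_gt // nth_default ?size_map ?size_iota.
rewrite (nth_map 0%N) ?size_iota // nth_iota // nth_fvector add0n.
by rewrite -(fcountC n psi) addnK.
Qed.

(** * Hilbert functions of a squarefree monomial ideal and its quotient *)

Section Coordinates.
Variables (K : fieldType) (n : nat).
Local Notation S := {mpoly K[n]}.
Variable N : lmodType S.

(** A basis indexed by a list without repetition, certified by its coordinate
    functions [kappa]. *)
Lemma has_dim_coords (W : N -> Prop) (T : eqType) (L : seq T) (B : T -> N)
    (kappa : N -> T -> K) : uniq L ->
  (forall c : T -> K, W (\sum_(t <- L) (c t)%:MP *: B t)) ->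
  (forall v, W v -> v = \sum_(t <- L) (kappa v t)%:MP *: B t) ->
  (forall (c : T -> K) t, t \in L ->
     kappa (\sum_(t <- L) (c t)%:MP *: B t) t = c t) ->
  has_dim W (size L).
Proof.
move=> uL Wc vE kE; apply/has_dimP.
pose b i := B (tnth (in_tuple L) i); exists b.
have bE (c : T -> K) : lincomb b (fun i => c (tnth (in_tuple L) i)) =
    \sum_(t <- L) (c t)%:MP *: B t by rewrite [RHS]big_tnth.
have ext (c : 'I_(size L) -> K) :
    exists c' : T -> K, c =1 (fun i => c' (tnth (in_tuple L) i)).
  exists (fun t => if insub (index t L) is Some i then c i else 0) => i.
  rewrite (tnth_nth (tnth (in_tuple L) i)) /= index_uniq //.
  by case: insubP => [j _ /val_inj->//|]; rewrite ltn_ord.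
split=> [c|v /vE vE'|c c0 i].
- by have [c' cc'] := ext c; rewrite (eq_lincomb _ cc') bE.
- by exists (fun i => kappa v (tnth (in_tuple L) i)); rewrite bE.
have [c' cc'] := ext c; move: c0; rewrite (eq_lincomb _ cc') bE cc' => c'0.
have memL : tnth (in_tuple L) i \in L by exact: mem_tnth.
rewrite -(kE c' _ memL) c'0.
have <- : \sum_(t <- L) (0 : K)%:MP *: B t = 0.
  by rewrite big1 // => t _; rewrite mpolyC0 scale0r.
exact: (kE (fun=> 0)).
Qed.

Lemma hilbert_functionE (gr : int -> N -> Prop) d r :
  has_dim (gr d) r -> hilbert_function gr d = r.
Proof.
move=> gr_r; apply: (has_dim_inj _ gr_r).
by apply: (epsilon_spec (inhabits 0%N) (has_dim (gr d))); exists r.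
Qed.

Lemma hilbert_function_zero (gr : int -> N -> Prop) d :
  (forall v, gr d v <-> v = 0) -> hilbert_function gr d = 0%N.
Proof.
move=> gr0; apply: hilbert_functionE.
apply: (@has_dim_coords _ nat [::] (fun=> 0) (fun _ _ => 0)) => // [c|v].
  by rewrite big_nil; apply/gr0.
by rewrite big_nil => /gr0.
Qed.

End Coordinates.

(** The list [x] may be shorter than [n]: the variables beyond it get exponent 0.
    This serves monomials in the first variables only. *)
Definition mn_of n (x : seq nat) : 'X_{1..n} := [multinom nth 0%N x i | i < n].

Definition monomials n d : seq 'X_{1..n} := [seq mn_of n x | x <- exponents n d].

Lemma mn_of_inj n m x y : (m <= n)%N -> size x = m -> size y = m ->
  mn_of n x = mn_of n y -> x = y.
Proof.
move=> le_mn sx sy /mnmP xy; apply: (@eq_from_nth _ 0%N); rewrite sx // => i lt_i.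
by have := xy (Ordinal (leq_trans lt_i le_mn)); rewrite !mnmE.
Qed.

Lemma mdeg_mn_of n m x : (m <= n)%N -> size x = m -> mdeg (mn_of n x) = sumn x.
Proof.
move=> le_mn sx; rewrite mdegE sumnE (big_nth 0%N) big_mkord sx.
rewrite (big_ord_widen _ (fun i => nth 0%N x i) le_mn) [RHS]big_mkcond /=.
apply: eq_bigr => i _; rewrite mnmE; case: ltnP => // le_mi.
by rewrite nth_default ?sx.
Qed.

Lemma monomials_uniq n d : uniq (monomials n d).
Proof.
rewrite map_inj_in_uniq ?exponents_uniq // => x y; rewrite !mem_exponents.
by move=> /andP[/eqP sx _] /andP[/eqP sy _]; exact: (mn_of_inj (leqnn n)).
Qed.

Lemma mem_monomials n d m : (m \in monomials n d) = (mdeg m == d).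
Proof.
apply/mapP/idP => [[x]|/eqP <-].
  by rewrite mem_exponents => /andP[/eqP sx /eqP <-] ->; rewrite (@mdeg_mn_of _ n) ?eqxx.
have mE : m = mn_of n [seq m i | i <- enum 'I_n].
  apply/mnmP => i; rewrite mnmE (nth_map i) ?size_enum_ord // nth_ord_enum.
  by [].
exists [seq m i | i <- enum 'I_n] => //.
rewrite mem_exponents size_map size_enum_ord eqxx /=; apply/eqP.
by rewrite {2}mE (@mdeg_mn_of _ n) // size_map size_enum_ord.
Qed.

Section SquarefreeIdeal.
Variables (K : fieldType) (n : nat).
Local Notation S := {mpoly K[n]}.
Variables (I : idealr S) (k : nat) (g : 'I_k -> 'X_{1..n}).
Hypotheses (g_sqf : forall i, squarefree_monomial (g i))
  (IG : forall p : S, p \in I <-> exists c : 'I_k -> S, p = \sum_(i < k) c i * 'X_[g i]).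

Definition in_monoms (m : 'X_{1..n}) : bool := [exists i, (g i <= m)%MM].

Lemma mpolyX_mem m : in_monoms m -> 'X_[m] \in I.
Proof.
move=> /existsP[i gm]; apply/IG; exists (fun j => if j == i then 'X_[m - g i] else 0).
rewrite (bigD1 i) //= eqxx big1 ?addr0 => [|j /negPf->]; last by rewrite mul0r.
by rewrite -mpolyXD submK.
Qed.

Lemma mem_idealP (p : S) : p \in I <-> (forall m, m \in msupp p -> in_monoms m).
Proof.
split=> [/IG[c ->] m|pm].
  rewrite mcoeff_msupp; apply: contraNT => /existsPn gm.
  rewrite raddf_sum big1 // => i _ /=; apply: memN_msupp_eq0.
  rewrite (perm_mem (msuppMX _ _)); apply: contra (gm i) => /mapP[m' _ ->].
  by apply/mnm_lepP => j; rewrite mnmDE leq_addr.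
rewrite [p]mpolyE; rewrite big_seq; apply: (rpred_sum (S := I)) => m /pm /mpolyX_mem.
by rewrite -mul_mpolyC; exact: idealMr.
Qed.

Definition support_mem (s : seq bool) : bool :=
  in_monoms [multinom (nth false s i : nat) | i < n].

(** The generators being squarefree, membership of a monomial depends on its support
    only. *)
Lemma in_monoms_support x : size x = n ->
  in_monoms (mn_of n x) = support_mem (map (leq 1) x).
Proof.
move=> sx; apply: eq_existsb => i; apply/mnm_lepP/mnm_lepP => le j.
all: have := le j; rewrite !mnmE (nth_map 0%N) ?sx //.
all: have /forallP/(_ j) := g_sqf i.
all: by case: (g i j) => [|[|]] //; case: (nth 0%N x j).
Qed.

Lemma support_mem_antitone : antitone n (negb \o support_mem).
Proof.
move=> s t sz st /=; apply: contra => /existsP[i /mnm_lepP gs].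
apply/existsP; exists i; apply/mnm_lepP => j; rewrite mnmE.
apply: leq_trans (gs j) _; rewrite mnmE; move: (val j) => {gs sz} l.
elim: s t l st => [|b s IHs] [|b' t] [|l] //= /andP[bb' st]; last exact: IHs.
by case: b b' bb' => [] [].
Qed.

Lemma mcoeff_sum_monoms (L : seq 'X_{1..n}) (c : 'X_{1..n} -> K) m : uniq L ->
  (\sum_(m <- L) (c m)%:MP * 'X_[m] : S)@_m = if m \in L then c m else 0.
Proof.
move=> uL; rewrite raddf_sum /=.
under eq_bigr do rewrite mcoeffCM mcoeffX.
have [mL|mL] := boolP (m \in L).
  rewrite (bigD1_seq m) //= eqxx mulr1 big1 ?addr0 // => m' /negPf->.
  by rewrite mulr0.
rewrite big_seq big1 // => m' m'L; case: eqP => [eq_m|]; last by rewrite mulr0.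
by rewrite -eq_m m'L in mL.
Qed.

Lemma ideal_hilbert d : hilbert_function (ideal_gr I) (Posz d) =
  count (support_mem \o map (leq 1)) (exponents n d).
Proof.
pose L := [seq m <- monomials n d | in_monoms m].
have uL : uniq L by rewrite filter_uniq // monomials_uniq.
have <- : size L = count (support_mem \o map (leq 1)) (exponents n d).
  rewrite size_filter count_map; apply: eq_in_count => x; rewrite mem_exponents.
  by case/andP=> /eqP sx _; exact: in_monoms_support.
pose B m : ideal_module I := insubd (0 : ideal_module I) ('X_[m] : S^o).
have BE m : in_monoms m -> ideal_val (B m) = 'X_[m].
  by move=> mI; rewrite -[LHS]/(val (B m)) val_insubd ifT //; exact: mpolyX_mem.
have valE (c : 'X_{1..n} -> K) : ideal_val (\sum_(m <- L) (c m)%:MP *: B m) =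
    \sum_(m <- L) (c m)%:MP * 'X_[m].
  rewrite -[LHS]/(val _) raddf_sum big_seq [RHS]big_seq; apply: eq_bigr => m.
  by rewrite mem_filter => /andP[/BE mI _]; rewrite -mI.
apply: hilbert_functionE.
apply: (has_dim_coords (B := B) (kappa := fun v m => (ideal_val v)@_m)) => //.
- move=> c; rewrite /ideal_gr valE /= big_seq; elim/big_ind: _ => //.
  + exact: dhomog0.
  + exact: dhomogD.
  + move=> m; rewrite mem_filter mem_monomials => /andP[_ /eqP md].
    by rewrite mul_mpolyC dhomogZ // dhomogX; apply/eqP.
- move=> v gv; apply: val_inj; rewrite -[RHS]/(ideal_val _) valE.
  rewrite -[LHS]/(ideal_val v); apply/mpolyP => m; rewrite mcoeff_sum_monoms //.
  case: ifPn => //; rewrite mem_filter mem_monomials => mL; apply: memN_msupp_eq0.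
  apply: contra mL => mv; apply/andP; split; last first.
    by apply/eqP; have /dhomogP := gv; apply.
  have vI : ideal_val v \in I by case: (v).
  by have /mem_idealP := vI; apply.
- by move=> c m mL; rewrite valE mcoeff_sum_monoms // mL.
Qed.

Lemma ideal_hilbert_neg d : hilbert_function (ideal_gr I) (Negz d) = 0%N.
Proof.
apply: hilbert_function_zero => v; rewrite /ideal_gr /=; split=> [/eqP v0|->].
  exact: val_inj.
by [].
Qed.

Local Notation pi := (\pi_{ideal_quot I})%qT.

Lemma pi_eq (p q : S) : p - q \in I -> pi p = pi q.
Proof. by rewrite Quotient.idealrBE => /eqP. Qed.

(** The coefficients at monomials outside the ideal are well defined on the
    quotient; they are the coordinates there. *)
Lemma mcoeff_repr (p : S) m : ~~ in_monoms m -> (repr (pi p))@_m = p@_m.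
Proof.
move=> mI; apply/eqP; rewrite -subr_eq0 -mcoeffB mcoeff_eq0.
apply: contra mI; have : repr (pi p) - p \in I.
  by rewrite Quotient.idealrBE reprK.
by move=> /mem_idealP; apply.
Qed.

Lemma quot_hilbert d : hilbert_function (quot_gr I) (Posz d) =
  count ((negb \o support_mem) \o map (leq 1)) (exponents n d).
Proof.
pose L := [seq m <- monomials n d | ~~ in_monoms m].
have uL : uniq L by rewrite filter_uniq // monomials_uniq.
have <- : size L = count ((negb \o support_mem) \o map (leq 1)) (exponents n d).
  rewrite size_filter count_map; apply: eq_in_count => x; rewrite mem_exponents.
  by case/andP=> /eqP sx _ /=; rewrite in_monoms_support.
have piE (c : 'X_{1..n} -> K) : \sum_(m <- L) (c m)%:MP *: pi 'X_[m] =
    pi (\sum_(m <- L) (c m)%:MP * 'X_[m]).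
  rewrite rmorph_sum; apply: eq_bigr => m _.
  by rewrite rmorphM.
apply: hilbert_functionE.
apply: (has_dim_coords (B := fun m => pi 'X_[m]) (kappa := fun v m => (repr v)@_m)) => //.
- move=> c; exists (\sum_(m <- L) (c m)%:MP * 'X_[m]); last exact: piE.
  rewrite /= big_seq; elim/big_ind: _ => //.
  + exact: dhomog0.
  + exact: dhomogD.
  + move=> m; rewrite mem_filter mem_monomials => /andP[_ /eqP md].
    by rewrite mul_mpolyC dhomogZ // dhomogX; apply/eqP.
- move=> _ [p hp ->]; rewrite piE; apply: pi_eq; apply/mem_idealP => m.
  rewrite mcoeff_msupp; apply: contraNT => mI.
  rewrite mcoeffB mcoeff_sum_monoms // mem_filter mI mem_monomials /= mcoeff_repr //.
  case: (mdeg m =P d) => [_|md]; first by rewrite subrr.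
  rewrite subr0; apply/eqP/memN_msupp_eq0/negP => pm; apply: md.
  by move/dhomogP: hp; apply.
- move=> c m mL; rewrite piE mcoeff_repr ?mcoeff_sum_monoms ?mL //.
  by move: mL; rewrite mem_filter => /andP[].
Qed.

Lemma quot_hilbert_neg d : hilbert_function (quot_gr I) (Negz d) = 0%N.
Proof.
apply: hilbert_function_zero => v; split=> [[p /eqP -> ->]|->].
  exact: rmorph0.
by exists 0; rewrite ?rmorph0 //= eqxx.
Qed.

End SquarefreeIdeal.

(** * Direct sums of shifted polynomial rings *)

Section Kill.
Variables (K : fieldType) (n : nat).
Local Notation S := {mpoly K[n]}.

Definition kill (P : pred 'I_n) (p : S) : S :=
  p \mPo [tuple if P i then 0 else 'X_i | i < n].

Definition avoids (P : pred 'I_n) (m : 'X_{1..n}) := [forall i, P i ==> (m i == 0%N)].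

HB.instance Definition _ P := GRing.RMorphism.copy (kill P)
  (comp_mpoly [tuple if P i then 0 else 'X_i : S | i < n]).

Lemma killX P m : kill P 'X_[m] = if avoids P m then 'X_[m] else 0.
Proof.
rewrite /kill comp_mpolyX; case: ifPn => [/forallP av|/forallPn[i]].
  rewrite [RHS]mpolyXE_id; apply: eq_bigr => i _; rewrite tnth_mktuple.
  by have := av i; case: (P i) => //= /eqP->.
rewrite negb_imply => /andP[Pi mi].
by rewrite (bigD1 i) //= tnth_mktuple Pi expr0n (negPf mi) mul0r.
Qed.

Lemma killZ P c p : kill P (c *: p) = c *: kill P p.
Proof. exact: comp_mpolyZ. Qed.

Lemma mcoeff_kill P p m : (kill P p)@_m = if avoids P m then p@_m else 0.
Proof.
rewrite [p in LHS]mpolyE rmorph_sum raddf_sum /=.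
under eq_bigr do rewrite killZ mcoeffZ killX.
have [pm|pm] := boolP (m \in msupp p).
  rewrite (bigD1_seq m) ?msupp_uniq //= big1 => [|m' /negPf m'm].
    by rewrite addr0; case: ifP; rewrite ?mcoeffX ?eqxx ?mulr1 // mcoeff0 mulr0.
  by case: ifP; rewrite ?mcoeffX ?m'm ?mcoeff0 mulr0.
rewrite (memN_msupp_eq0 pm) if_same big_seq big1 // => m' pm'.
case: ifP; rewrite ?mcoeff0 ?mulr0 // mcoeffX; case: eqP => [eqm|]; rewrite ?mulr0 //.
by rewrite -eqm pm' in pm.
Qed.

Lemma killK P p : kill P (kill P p) = kill P p.
Proof. by apply/mpolyP => m; rewrite !mcoeff_kill; case: avoids. Qed.

Lemma killC P Q p : kill P (kill Q p) = kill Q (kill P p).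
Proof. by apply/mpolyP => m; rewrite !mcoeff_kill; do 2!case: avoids. Qed.

Lemma avoidsX P i : avoids P U_(i) = ~~ P i.
Proof.
apply/forallP/idP => [/(_ i)|Pi j].
  by rewrite mnm1E eqxx implybF.
by apply/implyP => Pj; rewrite mnm1E; case: (i =P j) => // ij; rewrite ij Pj in Pi.
Qed.

Lemma killXU P i : kill P 'X_i = if P i then 0 else 'X_i.
Proof. by rewrite killX avoidsX; case: (P i). Qed.

Lemma kill_homog P e p : p \is e.-homog -> kill P p \is e.-homog.
Proof.
move=> /dhomogP hp; apply/dhomogP => m; rewrite mcoeff_msupp mcoeff_kill.
by case: ifP; rewrite ?eqxx // -mcoeff_msupp => _ /hp.
Qed.

Lemma kill_divX i p : exists q, p = kill (pred1 i) p + 'X_i * q.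
Proof.
exists (\sum_(m <- msupp p | m i != 0%N) p@_m *: 'X_[m - U_(i)]).
rewrite [p in LHS]mpolyE (bigID (fun m : 'X_{1..n} => m i == 0%N)) /=.
congr (_ + _).
  rewrite [p in RHS]mpolyE raddf_sum big_mkcond /=; apply: eq_bigr => m _.
  rewrite killZ killX.
  have -> : avoids (pred1 i) m = (m i == 0%N).
    apply/forallP/idP => [/(_ i)|mi j]; first by rewrite /= eqxx.
    by apply/implyP => /eqP ->.
  by case: eqP => // _; rewrite scaler0.
rewrite mulr_sumr; apply: eq_bigr => m mi; rewrite -scalerAr -mpolyXD addmC submK //.
by apply/mnm_lepP => j; rewrite mnm1E; case: eqP => // <-; rewrite lt0n.
Qed.

Lemma mpoly_grP d (p : S) :
  reflect (forall m, p@_m != 0 -> (mdeg m)%:Z = d) (mpoly_gr d p).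
Proof.
case: d => d /=; last first.
  apply: (iffP eqP) => [-> m|p0]; first by rewrite mcoeff0 eqxx.
  by apply/mpolyP => m; rewrite mcoeff0; apply: contraPeq (p0 m) => /[swap] /[apply].
apply: (iffP idP) => [/dhomogP hp m|hp]; first by rewrite -mcoeff_msupp => /hp ->.
by apply/dhomogP => m; rewrite mcoeff_msupp => /hp [].
Qed.

Lemma mcoeff_proj d (p : S) m :
  (mpoly_proj d p)@_m = if (mdeg m)%:Z == d then p@_m else 0.
Proof.
case: d => d; rewrite /mpoly_proj; last by rewrite mcoeff0.
rewrite pihomogE raddf_sum eqz_nat big_mkcond /=.
transitivity (\sum_(m' <- msupp p | m' == m) if mdeg m == d then p@_m else 0).
  rewrite [RHS]big_mkcond; apply: eq_bigr => m' _; rewrite mcoeffZ mcoeffX.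
  by case: (m' =P m) => [->|_]; case: ifP; rewrite ?mulr1 ?mulr0.
have [pm|pm] := boolP (m \in msupp p).
  by rewrite -big_filter filter_pred1_uniq ?msupp_uniq // big_seq1.
rewrite (memN_msupp_eq0 pm) if_same big1 //.
Qed.

End Kill.

Section SumOfPolynomialRings.
Variables (K : fieldType) (n r : nat) (a : 'I_r -> nat).
Local Notation S := {mpoly K[n]}.

Definition outside j : pred 'I_n := fun i => (a j <= i)%N.

Definition in_vars (v : {ffun 'I_r -> S}) : bool :=
  [forall j, kill (outside j) (v j) == v j].

(** The direct sum over [j] of the rings [K[x_1, ..., x_(a j)]], each a module over
    the whole polynomial ring through the quotient by the other variables.  Its
    elements are tuples of polynomials fixed by the substitution of 0 for these
    variables, and the scalars act after the same substitution. *)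
Record polysum := PolySum { pval : {ffun 'I_r -> S}; _ : in_vars pval }.

Arguments pval : simpl never.

HB.instance Definition _ := [isSub for pval].
HB.instance Definition _ := [Choice of polysum by <:].

Lemma in_vars_zmod_closed : zmod_closed (in_vars : {pred {ffun 'I_r -> S}}).
Proof.
split=> [|u v /forallP uV /forallP vV]; apply/forallP => j; rewrite !ffunE.
  by rewrite raddf0.
by rewrite rmorphB /= (eqP (uV j)) (eqP (vV j)).
Qed.

HB.instance Definition _ := GRing.SubChoice_isSubZmodule.Build
  {ffun 'I_r -> S} in_vars polysum in_vars_zmod_closed.

Lemma polysumP (v : polysum) j : kill (outside j) (pval v j) = pval v j.
Proof. by have /forallP/(_ j)/eqP := valP v. Qed.

Lemma polysum_ext (u v : polysum) : (forall j, pval u j = pval v j) -> u = v.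
Proof. by move=> uv; apply: val_inj; apply/ffunP. Qed.

Lemma in_vars_kill (f : 'I_r -> S) : in_vars [ffun j => kill (outside j) (f j)].
Proof. by apply/forallP => j; rewrite ffunE killK. Qed.

Definition mk_polysum f := PolySum (in_vars_kill f).

Lemma mk_polysumE f j : pval (mk_polysum f) j = kill (outside j) (f j).
Proof. by rewrite ffunE. Qed.

Definition polysum_scale (p : S) (v : polysum) := mk_polysum (fun j => p * pval v j).

Lemma polysum_scaleE p v j :
  pval (polysum_scale p v) j = kill (outside j) p * pval v j.
Proof. by rewrite mk_polysumE rmorphM /= polysumP. Qed.

Lemma pvalD u v j : pval (u + v) j = pval u j + pval v j.
Proof. by rewrite -[pval (u + v)]/(val (u + v)) raddfD ffunE. Qed.

Lemma polysum_scaleA p q v :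
  polysum_scale p (polysum_scale q v) = polysum_scale (p * q) v.
Proof.
by apply: polysum_ext => j; rewrite !polysum_scaleE rmorphM mulrA.
Qed.
Lemma polysum_scale1 : left_id 1 polysum_scale.
Proof. by move=> v; apply: polysum_ext => j; rewrite polysum_scaleE rmorph1 mul1r. Qed.
Lemma polysum_scaleDr : right_distributive polysum_scale +%R.
Proof.
by move=> p u v; apply: polysum_ext => j; rewrite pvalD !polysum_scaleE pvalD mulrDr.
Qed.
Lemma polysum_scaleDl v : {morph polysum_scale^~ v : p q / p + q}.
Proof.
by move=> p q; apply: polysum_ext => j; rewrite pvalD !polysum_scaleE rmorphD mulrDl.
Qed.

HB.instance Definition _ := GRing.Zmodule_isLmodule.Build S polysum
  polysum_scaleA polysum_scale1 polysum_scaleDr polysum_scaleDl.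

Lemma pvalZ (p : S) (v : polysum) j : pval (p *: v) j = kill (outside j) p * pval v j.
Proof. exact: polysum_scaleE. Qed.

Lemma pval0 j : pval (0 : polysum) j = 0.
Proof. by rewrite -[pval 0]/(val (0 : polysum)) raddf0 ffunE. Qed.

Lemma pval_sum J (s : seq J) (f : J -> polysum) j :
  pval (\sum_(i <- s) f i) j = \sum_(i <- s) pval (f i) j.
Proof.
exact: (big_morph (fun v => pval v j) (fun u v => pvalD u v j) (pval0 j)).
Qed.

End SumOfPolynomialRings.

Arguments pval : simpl never.

Section PolySumModule.
Variables (K : fieldType) (n r : nat) (a s : 'I_r -> nat).
Hypothesis le_an : forall j, (a j <= n)%N.
Local Notation S := {mpoly K[n]}.
Local Notation N := (polysum K n a).

(** The summand [j] is generated in degree [s j]. *)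
Definition polysum_gr (d : int) (v : N) : Prop :=
  forall j, mpoly_gr (d - (s j)%:Z) (pval v j).

Definition unit_vec (j : 'I_r) : N := mk_polysum a (fun j' => (j' == j)%:R).

Lemma unit_vecE j j' : pval (unit_vec j) j' = (j' == j)%:R.
Proof. by rewrite mk_polysumE rmorph_nat. Qed.

Lemma polysum_fg : finitely_generated N.
Proof.
exists r, unit_vec => v; exists (fun j => pval v j); apply: polysum_ext => j.
rewrite pval_sum (bigD1 j) //= pvalZ unit_vecE eqxx mulr1 polysumP.
by rewrite big1 ?addr0 // => j' /negPf; rewrite pvalZ unit_vecE eq_sym => ->; rewrite mulr0.
Qed.

Lemma kill_gr P d (p : S) : mpoly_gr d p -> mpoly_gr d (kill P p).
Proof.
move=> /mpoly_grP hp; apply/mpoly_grP => m; rewrite mcoeff_kill.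
by case: ifP; rewrite ?eqxx // => _ /hp.
Qed.

Lemma polysum_is_grading : is_grading polysum_gr.
Proof.
split.
- by move=> d j; rewrite pval0 mpoly_gr0.
- by move=> d u v gu gv j; rewrite pvalD mpoly_grD.
- move=> e d p v hp gv j; rewrite pvalZ -addrA; apply: mpoly_grM; last exact: gv.
  exact: kill_homog.
- move=> v.
  pose f d : N := mk_polysum a (fun j => mpoly_proj (d - (s j)%:Z) (pval v j)).
  pose B := (\sum_j (msize (pval v j) + s j))%N.
  exists [seq Posz i | i <- iota 0 B], f; split.
  + by rewrite map_inj_uniq ?iota_uniq // => x y [].
  + by move=> d j; rewrite mk_polysumE; apply: kill_gr; exact: mpoly_projP.
  + apply: polysum_ext => j; rewrite pval_sum big_map.
    apply/mpolyP => m; rewrite raddf_sum /=.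
    under eq_bigr do rewrite mk_polysumE mcoeff_kill mcoeff_proj.
    have [pm|pm] := boolP (m \in msupp (pval v j)); last first.
      rewrite (memN_msupp_eq0 pm) big1 // => i _; by rewrite !if_same.
    have lt_m : (mdeg m + s j < B)%N.
      rewrite /B (bigD1 j) //= -addnA -addSn leq_add ?msize_mdeg_lt //.
      by rewrite leq_addr.
    have -> : (pval v j)@_m = if avoids (outside a j) m then (pval v j)@_m else 0.
      by rewrite -mcoeff_kill polysumP.
    rewrite (bigD1_seq (mdeg m + s j)%N) ?iota_uniq ?mem_iota //=.
    rewrite PoszD addrK eqxx big1 ?addr0; first by case: ifP => // ->.
    move=> i /negPf ne_i; case: ifP => // _; rewrite ifF //.
    by rewrite eq_sym subr_eq -PoszD eqz_nat.
- move=> l f ul gf f0 d dl; apply: polysum_ext => j; rewrite pval0.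
  apply/mpolyP => m; rewrite mcoeff0.
  have := congr1 (fun v : N => (pval v j)@_m) f0.
  rewrite pval_sum pval0 raddf_sum mcoeff0 (bigD1_seq d) //= => fd0.
  have [//|nz] := eqVneq (pval (f d) j)@_m 0.
  have /mpoly_grP/(_ m nz) md := gf d j.
  move: fd0; rewrite big1 ?addr0 // => e /eqP ne.
  apply/eqP/negP => /negP nze; apply: ne.
  by have /mpoly_grP/(_ m nze) := gf e j; rewrite md => /addIr.
Qed.

Lemma mem_outside j m e : (m \in [seq mn_of n x | x <- exponents (a j) e]) =
  avoids (outside a j) m && (mdeg m == e).
Proof.
apply/mapP/andP => [[x]|[/forallP av /eqP <-]].
  rewrite mem_exponents => /andP[/eqP sx /eqP <-] ->.
  rewrite (mdeg_mn_of (le_an j)) // eqxx; split=> //.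
  apply/forallP => i; apply/implyP => ai; rewrite mnmE nth_default // sx.
  exact: ai.
pose x := mkseq (fun l => if insub l is Some i then m i else 0%N) (a j).
have sx : size x = a j by rewrite size_mkseq.
have mE : m = mn_of n x.
  apply/mnmP => i; rewrite mnmE; have [lt|ge] := ltnP i (a j).
    by rewrite nth_mkseq // valK.
  by rewrite nth_default ?sx //; have /implyP/(_ ge)/eqP := av i.
exists x => //; rewrite mem_exponents sx eqxx /=.
by have := congr1 mdeg mE; rewrite (mdeg_mn_of (le_an j)) // => ->.
Qed.

Lemma polysum_hilbert e : (hilbert_function polysum_gr (Posz e))%:Z =
  \sum_j shift (s j) (poly_hf (a j)) e.
Proof.
pose L0 j := if (s j <= e)%N then [seq mn_of n x | x <- exponents (a j) (e - s j)] else [::].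
pose L := [seq (j, m) | j <- enum 'I_r, m <- L0 j].
have memL j m : ((j, m) \in L) =
    avoids (outside a j) m && ((mdeg m)%:Z == e%:Z - (s j)%:Z).
  rewrite /L; apply/allpairsPdep/idP => [[j' [m' [_ m'L [-> ->]]]]|jm].
    move: m'L; rewrite /L0; case: leqP => // le_e; rewrite mem_outside.
    by move=> /andP[-> /eqP->]; rewrite subzn ?eqxx.
  exists j, m; rewrite mem_enum; split=> //.
  case/andP: jm => av; rewrite eq_sym subr_eq -PoszD eqz_nat => /eqP eE.
  by rewrite /L0 eE leq_addl mem_outside av addnK eqxx.
have uL : uniq L.
  apply: allpairs_uniq_dep; rewrite ?enum_uniq //.
    move=> j _; rewrite /L0; case: ifP => // _; rewrite map_inj_in_uniq ?exponents_uniq //.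
    move=> x y; rewrite !mem_exponents => /andP[/eqP sx _] /andP[/eqP sy _].
    exact: (mn_of_inj (le_an j)).
  by move=> [x x'] [y y'] _ _ /= [-> ->].
have <- : (size L)%:Z = \sum_j shift (s j) (poly_hf (a j)) e.
  rewrite /L size_allpairs_dep sumnE big_map big_enum /=.
  rewrite (big_morph Posz PoszD (erefl _)); apply: eq_bigr => j _.
  by rewrite /L0 /shift; case: ifP => // _; rewrite size_map.
congr Posz; apply: hilbert_functionE.
pose B (t : 'I_r * 'X_{1..n}) : N :=
  mk_polysum a (fun j => if j == t.1 then 'X_[t.2] else 0).
have coefE (c : 'I_r * 'X_{1..n} -> K) j m :
    (pval (\sum_(t <- L) (c t)%:MP *: B t) j)@_m =
    if (j, m) \in L then c (j, m) else 0.
  rewrite pval_sum raddf_sum /=.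
  have tE t : (pval ((c t)%:MP *: B t) j)@_m =
      if ((j, m) == t) && avoids (outside a j) m then c t else 0.
    rewrite pvalZ mk_polysumE {1}/kill comp_mpolyC mcoeffCM mcoeff_kill.
    case: t => j' m'; rewrite xpair_eqE /=.
    case: eqP => _ /=; last by rewrite mcoeff0 if_same mulr0.
    by rewrite mcoeffX eq_sym; case: eqP; case: ifP; rewrite /= ?mulr1 ?mulr0.
  under eq_bigr do rewrite tE.
  have [jmL|jmL] := boolP ((j, m) \in L).
    rewrite (bigD1_seq (j, m)) //= eqxx.
    move: (jmL); rewrite memL => /andP[-> _] /=.
    by rewrite big1 ?addr0 // => t /negPf; rewrite eq_sym => ->.
  rewrite big_seq big1 // => t tL; case: eqP => // eq_t.
  by rewrite -eq_t (negPf jmL) in tL.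
apply: (has_dim_coords (B := B) (kappa := fun v t => (pval v t.1)@_t.2)) => //.
- move=> c j; apply/mpoly_grP => m; rewrite coefE; case: ifP => [|_]; rewrite ?eqxx //.
  by rewrite memL => /andP[_ /eqP].
- move=> v gv; apply: polysum_ext => j; apply/mpolyP => m; rewrite coefE /=.
  rewrite memL; case: ifPn => //; rewrite negb_and => /orP[av|md].
    by rewrite -polysumP mcoeff_kill (negPf av).
  apply/eqP; apply: contraNT md => nz.
  by have /mpoly_grP/(_ m nz) := gv j => ->.
- by move=> c [j m] jmL; rewrite coefE jmL.
Qed.

Lemma polysum_hilbert_neg e : hilbert_function polysum_gr (Negz e) = 0%N.
Proof.
apply: hilbert_function_zero => v; split=> [gv|-> j]; last by rewrite pval0 mpoly_gr0.
apply: polysum_ext => j; rewrite pval0; have := gv j.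
by rewrite NegzE -opprD -PoszD addSn -NegzE => /eqP.
Qed.

Variable d : nat.
Hypotheses (le_dn : (d <= n)%N) (le_da : forall j, (d <= a j)%N).

Definition vars : seq S := [seq 'X_(widen_ord le_dn i) | i <- enum 'I_d].

Lemma size_vars : size vars = d.
Proof. by rewrite size_map size_enum_ord. Qed.

Lemma nth_vars i (lt_id : (i < d)%N) :
  vars`_i = 'X_(widen_ord le_dn (Ordinal lt_id)).
Proof.
rewrite (nth_map (Ordinal lt_id)) ?size_enum_ord //.
by rewrite -[i in nth _ _ i]/(val (Ordinal lt_id)) nth_ord_enum.
Qed.

Lemma kill_outside_var j (i : 'I_d) :
  kill (outside a j) ('X_(widen_ord le_dn i) : S) = 'X_(widen_ord le_dn i).
Proof. by rewrite killXU /outside /= leqNgt (leq_trans (ltn_ord i) (le_da j)). Qed.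

Definition first i : pred 'I_n := fun l => (l < i)%N.

(** Membership in [(x_1, ..., x_i) N] is tested by putting the first [i] variables to
    0.  For the converse, each variable in turn is split off by [kill_divX]. *)
Lemma in_seq_mul_vars i (v : N) : (i <= d)%N ->
  in_seq_mul (take i vars) v <-> forall j, kill (first i) (pval v j) = 0.
Proof.
elim: i v => [|i IHi] v lt_id.
  have k0 p : kill (first 0) p = p :> S.
    by apply/mpolyP => m; rewrite mcoeff_kill ifT //; apply/forallP.
  rewrite take0; split=> [[w ->] j|v0].
    by rewrite big_ord0 pval0 k0.
  exists (fun=> 0); rewrite big_ord0; apply: polysum_ext => j.
  by rewrite pval0 -[LHS]k0.
rewrite (take_nth 0) ?size_vars // -in_seq_mul_rcons (nth_vars lt_id).
set l := widen_ord _ _.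
have lE : val l = i by [].
have firstS p : kill (first i.+1) p = kill (first i) (kill (pred1 l) p) :> S.
  apply/mpolyP => m; rewrite !mcoeff_kill.
  suff -> : avoids (first i.+1) m = avoids (first i) m && avoids (pred1 l) m.
    by case: avoids; case: avoids.
  rewrite /avoids; apply/forallP/andP => [av|[/forallP av /forallP av'] x].
    split; apply/forallP => x; apply/implyP => ix; have /implyP := av x; apply.
      exact: ltnW.
    by rewrite (eqP ix) /first lE.
  apply/implyP; rewrite /first ltnS leq_eqVlt => /predU1P[xi|lt].
    by have /implyP := av' x; apply; apply/eqP/val_inj.
  by have /implyP := av x; apply.
split=> [[w [e [w0 ->]]] j|v0].
  rewrite pvalD pvalZ kill_outside_var rmorphD rmorphM /=.
  have -> : kill (first i.+1) ('X_l : S) = 0 by rewrite killXU /first lE ltnSn.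
  by rewrite mul0r addr0 firstS killC (IHi w (ltnW lt_id)).1 // rmorph0.
pose q j := sval (constructive_indefinite_description _ (kill_divX l (pval v j))).
have qE j : pval v j = kill (pred1 l) (pval v j) + 'X_l * q j.
  by rewrite /q; case: constructive_indefinite_description.
exists (mk_polysum a (fun j => kill (pred1 l) (pval v j))), (mk_polysum a q).
split.
  apply/(IHi _ (ltnW lt_id)) => j.
  by rewrite mk_polysumE killC -firstS v0 rmorph0.
apply: polysum_ext => j; rewrite pvalD pvalZ !mk_polysumE kill_outside_var.
by rewrite -[LHS]polysumP [X in kill _ X]qE rmorphD rmorphM /= kill_outside_var.
Qed.

(** The polynomial ring in the variables beyond the first [i] is a domain in which
    the next variable, present in every summand as [d <= a j], is nonzero. *)
Lemma polysum_regular : (0 < r)%N -> @regular_sequence _ _ N vars.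
Proof.
move=> r0; split=> [i|].
  rewrite size_vars => lt_id v; rewrite !in_seq_mul_vars ?(ltnW lt_id) // => kv j.
  have := kv j; rewrite (nth_vars lt_id) pvalZ kill_outside_var rmorphM /=.
  rewrite killXU /first ltnn => /eqP.
  rewrite mulf_eq0 => /orP[/eqP X0|/eqP //].
  set l := widen_ord _ _ in X0; have /eqP := congr1 (mcoeff U_(l)) X0.
  by rewrite mcoeffX eqxx mcoeff0 oner_eq0.
exists (unit_vec (Ordinal r0)); rewrite -[vars]take_size size_vars.
rewrite in_seq_mul_vars // => /(_ (Ordinal r0)) /eqP.
by rewrite unit_vecE eqxx rmorph1 oner_eq0.
Qed.

Lemma vars_maximal : {in vars, forall p, p@_0%MM = 0}.
Proof.
move=> p /mapP[i _ ->]; rewrite mcoeffX; case: eqP => // /mnmP/(_ (widen_ord le_dn i)).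
by rewrite mnm1E eqxx mnm0E.
Qed.

End PolySumModule.

(** * Hilbert depth *)

Lemma max_nat_spec (P : nat -> Prop) b : (exists k, P k) ->
  (forall k, P k -> (k <= b)%N) ->
  P (max_nat P) /\ forall k, P k -> (k <= max_nat P)%N.
Proof.
move=> exP leb; apply: (epsilon_spec (inhabits 0%N)
  (fun m => P m /\ forall k, P k -> (k <= m)%N)).
apply: NNPP => noP; have [k Pk] := exP.
have step m : exists2 k, P k & (m <= k)%N.
  elim: m => [|m [l Pl le_ml]]; first by exists k.
  apply: NNPP => nol; apply: noP; exists l; split=> // l' Pl'.
  rewrite leqNgt; apply/negP => lt_ll'; apply: nol; exists l' => //.
  exact: leq_ltn_trans lt_ll'.
by have [l /leb le_lb /leq_trans/(_ le_lb)] := step b.+1; rewrite ltnn.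
Qed.

(** The lengths of regular sequences are bounded, by [regular_diff_ge0] and
    [diffs_ge0_bound]; so the depth is attained, and subject to the same
    constraints. *)
Lemma depth_spec (K : fieldType) n (N : lmodType {mpoly K[n]})
    (gr : int -> N -> Prop) (a : nat -> nat) b :
  is_grading gr -> finitely_generated N -> hilbert_function gr (-1) = 0%N ->
  (forall e, (hilbert_function gr (Posz e))%:Z = hseries a n e) ->
  (forall j, (b < j)%N -> a j = 0%N) -> (exists e, hseries a n e != 0) ->
  [/\ (depth N <= b)%N, forall e, (0 <= iter (depth N) diff (hseries a n) e)%R &
    forall rs : seq {mpoly K[n]}, {in rs, forall p, p@_0%MM = 0} ->
      @regular_sequence _ _ N rs -> (size rs <= depth N)%N].
Proof.
move=> grN fgN h0 hE a0 nz.
have ge0 rs : {in rs, forall p, p@_0%MM = 0} -> @regular_sequence _ _ N rs ->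
    forall e, (0 <= iter (size rs) diff (hseries a n) e)%R.
  move=> rs0 reg e; rewrite -(eq_diffs _ hE).
  exact: regular_diff_ge0.
have le_b rs : {in rs, forall p, p@_0%MM = 0} -> @regular_sequence _ _ N rs ->
    (size rs <= b)%N.
  by move=> rs0 reg; apply: diffs_ge0_bound a0 _ nz; exact: ge0.
have [v vn0] : exists v : N, v <> 0.
  apply: NNPP => allz; have [e /eqP] := nz; apply; rewrite -hE.
  rewrite hilbert_function_zero // => v; split=> [_|->]; last exact: grading0.
  by apply: NNPP => vn0; apply: allz; exists v.
have [|k [rs [<- rs0 reg]]|[rs [rsd rs0 reg]] maxd] := max_nat_spec (b := b)
    (P := fun k => exists rs : seq {mpoly K[n]},
    [/\ size rs = k, {in rs, forall p, p@_0%MM = 0} & @regular_sequence _ _ N rs]).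
- exists 0%N, [::]; split=> //; split=> //; exists v => -[w vE].
  by apply: vn0; rewrite vE big_ord0.
- exact: le_b.
split.
- by rewrite /depth -rsd; exact: le_b.
- by rewrite /depth -rsd; exact: ge0.
- by move=> rs' rs'0 reg'; apply: maxd; exists rs'.
Qed.

Lemma fcount0 n phi : fcount n phi 0 = phi (nseq n false) :> nat.
Proof. by elim: n phi => // n IHn phi; rewrite fcountS addn0 IHn. Qed.

Lemma fcountn n phi : fcount n phi n = phi (nseq n true) :> nat.
Proof. by elim: n phi => // n IHn phi; rewrite fcountS fcount_gt // IHn. Qed.

Lemma sum_nseq T k (x : T) (F : T -> int) : \sum_(y <- nseq k x) F y = k%:Z * F x.
Proof.
elim: k => [|k IHk]; first by rewrite big_nil mul0r.
by rewrite big_cons IHk -addn1 PoszD mulrDl mul1r addrC.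
Qed.

Lemma polysum_exists (K : fieldType) n d (a : nat -> nat) : (d <= n)%N ->
  (forall e, (e <= d)%N -> (0 <= beta a d e)%R) -> (exists e, hseries a n e != 0) ->
  exists (N : lmodType {mpoly K[n]}) (gr : int -> N -> Prop)
         (rs : seq {mpoly K[n]}),
    [/\ is_grading gr, finitely_generated N,
      forall e, (hilbert_function gr (Posz e))%:Z = hseries a n e,
      forall e, hilbert_function gr (Negz e) = 0%N &
      [/\ size rs = d, {in rs, forall p, p@_0%MM = 0} & @regular_sequence _ _ N rs]].
Proof.
move=> le_dn ge0 nz.
(* Pairs of a number of variables and a generating degree, one for each summand of
   [hseries_decomp]. *)
pose ps : seq (nat * nat) :=
  flatten [seq nseq `|beta a d i|%N (d, i) | i <- iota 0 d.+1] ++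
  flatten [seq nseq (a j) (j, j) | j <- iota d.+1 (n - d)].
have psP p : p \in ps -> (d <= p.1 <= n)%N.
  rewrite mem_cat => /orP[] /flatten_mapP[i]; rewrite mem_iota => lei /nseqP[-> _] /=.
    by rewrite leqnn.
  by case/andP: lei => lti; rewrite addSn subnKC // ltnS => ->; rewrite ltnW.
pose t j := tnth (in_tuple ps) j.
have tP j : (d <= (t j).1 <= n)%N by apply: psP; exact: mem_tnth.
have le_an j : ((t j).1 <= n)%N by have /andP[] := tP j.
have le_da j : (d <= (t j).1)%N by have /andP[] := tP j.
have hE e : \sum_j shift (t j).2 (poly_hf (t j).1) e = hseries a n e.
  rewrite -(big_tnth _ _ ps xpredT (fun p => shift p.2 (poly_hf p.1) e)).
  rewrite (hseries_decomp _ _ le_dn) /ps big_cat; congr (_ + _).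
    rewrite big_flatten big_map big_seq [RHS]big_seq; apply: eq_bigr => i.
    rewrite mem_iota add0n ltnS /= => le_id.
    by rewrite sum_nseq gez0_abs // ge0.
  rewrite big_flatten big_map; apply: eq_bigr => j _.
  by rewrite sum_nseq.
have ps0 : (0 < size ps)%N.
  have [e] := nz; rewrite -hE lt0n; apply: contra => /eqP ps0.
  apply/eqP/big1 => j _; have := leq_ltn_trans (leq0n j) (ltn_ord j).
  by rewrite [X in (_ < X)%N]ps0.
exists (polysum K n (fun j => (t j).1)), (polysum_gr (fun j => (t j).2)),
  (vars K le_dn); split.
- exact: polysum_is_grading.
- exact: polysum_fg.
- by move=> e; rewrite polysum_hilbert.
- exact: polysum_hilbert_neg.
- split; [exact: size_vars | exact: vars_maximal | exact: polysum_regular].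
Qed.

Theorem corollary3p10 (K : fieldType) (n : nat) (I : idealr {mpoly K[n]})
    (I_neq0 : exists2 p, p \in I & p != 0)
    (I_sqfree : squarefree_monomial_ideal I) (n_le5 : (n <= 5)%N) :
  (hdepth (ideal_gr I) >= hdepth (quot_gr I) + 1)%N.
Proof.
have [k [g [g_sqf IG]]] := I_sqfree.
pose phi := support_mem g; pose psi := negb \o phi.
have hI e : (hilbert_function (ideal_gr I) (Posz e))%:Z = hseries (fcount n phi) n e.
  by rewrite (ideal_hilbert g_sqf IG) count_supp.
have hQ e : (hilbert_function (quot_gr I) (Posz e))%:Z = hseries (fcount n psi) n e.
  by rewrite (quot_hilbert g_sqf IG) count_supp.
have phi0 : phi (nseq n false) = false.
  case phi0E: (phi _) => //; have := mpolyX_mem IG (phi0E : is_true (in_monoms g _)).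
  rewrite (_ : [multinom _ | i < n] = 0%MM); last first.
    by apply/mnmP => i; rewrite mnmE nth_nseq if_same mnm0E.
  by rewrite mpolyX0 idealr1.
have phin : phi (nseq n true).
  have [p /(mem_idealP IG) pI p0] := I_neq0.
  have /existsP[i _] := pI _ (mlead_supp p0).
  apply/existsP; exists i; apply/mnm_lepP => j; rewrite mnmE nth_nseq ltn_ord.
  exact: (forallP (g_sqf i) j).
have nzI : exists e, hseries (fcount n phi) n e != 0.
  exists n; rewrite /hseries -count_supp eqz_nat -lt0n -has_count; apply/hasP.
  exists (nseq n 1%N); last by rewrite /= map_nseq.
  by rewrite mem_exponents size_nseq sumn_nseq mul1n !eqxx.
have nzQ : exists e, hseries (fcount n psi) n e != 0.
  exists 0%N; rewrite /hseries -count_supp eqz_nat -lt0n -has_count; apply/hasP.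
  exists (nseq n 0%N); last by rewrite /= map_nseq; apply: (contraFN _ phi0).
  by rewrite mem_exponents size_nseq sumn_nseq mul0n !eqxx.
have n0 : (0 < n)%N.
  by rewrite lt0n; apply/eqP => n0; move: phi0 phin; rewrite n0 /= => ->.
have psi0 : fcount n psi 0 = 1%N by rewrite fcount0 /psi /= phi0.
have psin : fcount n psi n = 0%N by rewrite fcountn /psi /= phin.
have psi_gt j : (n.-1 < j)%N -> fcount n psi j = 0%N.
  by rewrite prednK // leq_eqVlt => /predU1P[<-|/fcount_gt->].
have phi_gt j : (n < j)%N -> fcount n phi j = 0%N by move/fcount_gt->.
have [||[NQ [grQ [gradQ fgQ hNQ dQ]]] _] := max_nat_spec (b := n.-1)
    (P := fun k => exists (N : lmodType {mpoly K[n]}) (grN : int -> N -> Prop),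
      [/\ is_grading grN, finitely_generated N,
        hilbert_function grN =1 hilbert_function (quot_gr I) & depth N = k]).
- exists (depth {ideal_quot I}), {ideal_quot I}, (quot_gr I); split=> //.
    exact: quot_gr_is_grading.
  exact: ideal_quot_fg.
- move=> _ [N [grN [gradN fgN hN <-]]].
  have [|e|||//] := depth_spec gradN fgN (b := n.-1) (a := fcount n psi) => //.
  + by rewrite hN quot_hilbert_neg.
  + by rewrite hN.
rewrite -/(hdepth (quot_gr I)) in dQ.
have [|e|||le_dQ geQ _] := depth_spec gradQ fgQ (b := n.-1) (a := fcount n psi) => //.
- by rewrite hNQ quot_hilbert_neg.
- by rewrite hNQ.
have lt_dn : (hdepth (quot_gr I) < n)%N.
  by rewrite -dQ; apply: leq_ltn_trans le_dQ _; rewrite ltn_predL.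
have betaI e : (e <= (hdepth (quot_gr I)).+1)%N ->
    (0 <= beta (fcount n phi) (hdepth (quot_gr I)).+1 e)%R.
  move=> le_e; rewrite -(@eq_beta (fcount n (negb \o psi))); last first.
    by apply: eq_fcount => s; rewrite /= negbK.
  apply: beta_complement => //; first exact: support_mem_antitone.
  by move=> d le_d; rewrite -(beta_diffs _ (ltnW lt_dn)) // -dQ.
(* [N] is one of the modules among which the Hilbert depth of the ideal is the
   largest depth. *)
have [N [gr [rs [gradN fgN hN hN' [rs_d rs0 reg]]]]] :=
  polysum_exists K lt_dn betaI nzI.
have hilbN : hilbert_function gr =1 hilbert_function (ideal_gr I).
  case=> e; last by rewrite hN' ideal_hilbert_neg.
  by have := hN e; rewrite -hI => -[].
have [|||_ _ maxN] := depth_spec gradN fgN (hN' 0%N) (b := n) (a := fcount n phi) => //.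
rewrite addn1 -rs_d; apply: leq_trans (maxN rs rs0 reg) _.
have [||_ ] := max_nat_spec (b := n)
    (P := fun k => exists (N : lmodType {mpoly K[n]}) (grN : int -> N -> Prop),
      [/\ is_grading grN, finitely_generated N,
        hilbert_function grN =1 hilbert_function (ideal_gr I) & depth N = k]).
- by exists (depth N), N, gr.
- move=> _ [N' [grN' [gradN' fgN' hN2 <-]]].
  have [|e|||//] := depth_spec gradN' fgN' (b := n) (a := fcount n phi) => //.
  + by rewrite hN2 ideal_hilbert_neg.
  + by rewrite hN2.
by apply; exists N, gr.
Qed.
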